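(* Let $\gamma\subseteq\mathbb P^2$ be an irreducible conic and let $X=\mathbb S(\ell_1,\ldots,\ell_r)$, $Y=\mathbb S(m_1,\ldots,m_s)$ and $W=\mathbb S(n_1,\ldots,n_t)$ be contact star configurations on $\gamma$, where $t\ge r\ge s\ge2$ and all the $r+s+t$ tangent lines $\ell_i,m_j,n_k$ are distinct. Let $Z=(t-1)P_1+(r-1)P_2+(s-1)P_3$ be a scheme of three general fat points in $\mathbb P^2$. If $t\in\{r+s-1,\ r+s,\ r+s+1\}$, then $$h_{X\cup Y\cup W}=h_Z=(1,2,\ldots,t-2,\,t-1,\ \underbrace{r+s-2,\ r+s-4,\ \ldots,\ r-s+2}_{s-1},\ \underbrace{r-s,\ r-s-1,\ r-s-2,\ \ldots,\ 1}_{r-s}),$$ where the last group is empty if $r=s$.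
   Context: Work over $\mathbb C$ with $S=\mathbb C[x,y,z]=\mathbb C[\mathbb P^2]$. A set of $r\ge2$ lines in $\mathbb P^2$ meets properly if the lines are distinct and no three of them are concurrent; the star configuration $\mathbb S(\ell_1,\ldots,\ell_r)$ defined by such lines is the set of the $\binom r2$ points $\ell_i\cap\ell_j$, $i<j$. A contact star configuration on an irreducible conic $\gamma$ is a star configuration $\mathbb S(\ell_1,\ldots,\ell_r)$ where $\ell_1,\ldots,\ell_r$ are the tangent lines to $\gamma$ at $r$ distinct points of $\gamma$ (such lines always meet properly). For a zero-dimensional scheme $X\subseteq\mathbb P^2$ with saturated homogeneous ideal $I_X$ (for a finite set of points, the ideal of all forms vanishing on it), the Hilbert function is $H_X(d)=\dim S_d-\dim(I_X)_d$ and the $h$-vector is its first difference $h_X(d)=H_X(d)-H_X(d-1)$, with $H_X(-1)=0$, written as the sequence $(h_X(0),h_X(1),\ldots)$ with trailing zeros omitted. The scheme of fat points $m_1P_1+m_2P_2+m_3P_3$ is defined by the ideal $I_{P_1}^{m_1}\cap I_{P_2}^{m_2}\cap I_{P_3}^{m_3}$; ''general'' for three points means not lying on a line. *)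

(* Defs.v *)
From HB Require Import structures.
From mathcomp Require Import all_boot all_order all_algebra.
From mathcomp Require Import boolp classical_sets reals complex mpoly.

Set Implicit Arguments.
Unset Strict Implicit.
Unset Printing Implicit Defensive.

Import GRing.Theory.
Local Open Scope ring_scope.
Local Open Scope classical_set_scope.

(* Points and lines of P^2 are the subspaces of F^3 of dimension 1 and 2, so
   that incidence is inclusion and equality is the expected one. *)
Section Plane.
Variable F : fieldType.

Record plane_point := Point {
  point_space :> {vspace 'rV[F]_3};
  _ : \dim point_space == 1%N }.

HB.instance Definition _ := [isSub for point_space].
HB.instance Definition _ := [Choice of plane_point by <:].

Record plane_line := Line {
  line_space :> {vspace 'rV[F]_3};
  _ : \dim line_space == 2%N }.

HB.instance Definition _ := [isSub for line_space].
HB.instance Definition _ := [Choice of plane_line by <:].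

Definition on_line (P : plane_point) (L : plane_line) : bool := (P <= L)%VS.

Definition collinear (P1 P2 P3 : plane_point) : Prop :=
  exists L : plane_line, [&& on_line P1 L, on_line P2 L & on_line P3 L].

Definition star (r : nat) (l : 'I_r -> plane_line) : set plane_point :=
  [set P | exists i j : 'I_r, [/\ (i < j)%N, on_line P (l i) & on_line P (l j)]].

End Plane.

Section Ideals.
Variable A : comNzRingType.

Definition ideal_gen (G : set A) : set A :=
  [set p | exists s : seq (A * A),
     (forall x, x \in s -> G x.2) /\ p = \sum_(x <- s) x.1 * x.2].

Definition ideal_pow (I : set A) (m : nat) : set A :=
  ideal_gen [set p | exists b : m.-tuple A,
    (forall f, f \in b -> I f) /\ p = \prod_(f <- b) f].

End Ideals.

Definition irreducible_elt (A : idomainType) (p : A) : Prop :=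
  [/\ p != 0, p \isn't a GRing.unit &
    forall a b : A, p = a * b -> a \is a GRing.unit \/ b \is a GRing.unit].

Section Forms.
Variable F : fieldType.
Implicit Types (f q : {mpoly F[3]}) (P : plane_point F) (L : plane_line F).
Implicit Types (X : set (plane_point F)) (I : set {mpoly F[3]}).

Definition is_form f : Prop := exists d : nat, f \is d.-homog.

(* Meant for forms: the value at one nonzero vector of P decides. *)
Definition vanishes_at f P : Prop := forall v, v \in point_space P -> f.@[v 0] = 0.

Definition irreducible_conic q : Prop := q \is 2.-homog /\ irreducible_elt q.

Definition tangent_at q P L : Prop :=
  vanishes_at q P /\
  forall v, v \in point_space P -> v != 0 ->
  forall w, (w \in line_space L) = (\sum_(i < 3) (q^`M(i)).@[v 0] * w 0 i == 0).

(* Tangents to an irreducible conic at distinct points are distinct and no three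
   are concurrent, so that this need not be required separately. *)
Definition contact_star q (r : nat) (l : 'I_r -> plane_line F) : Prop :=
  exists2 P : 'I_r -> plane_point F, injective P & forall i, tangent_at q (P i) (l i).

Definition ideal_of X : set {mpoly F[3]} :=
  ideal_gen [set f | is_form f /\ forall P, X P -> vanishes_at f P].

Definition fat_ideal (P1 P2 P3 : plane_point F) (m1 m2 m3 : nat) : set {mpoly F[3]} :=
  ideal_pow (ideal_of [set P1]) m1 `&` ideal_pow (ideal_of [set P2]) m2
    `&` ideal_pow (ideal_of [set P3]) m3.

(* The subspace I_d of S_d = dhomog 3 F d; see mem_graded_piece. *)
Definition graded_piece I (d : nat) : {vspace dhomog 3 F d} :=
  xget 0%VS [set U : {vspace dhomog 3 F d} |
    forall f : dhomog 3 F d, f \in U <-> I (mpoly_of_dhomog f)].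

Lemma mem_graded_piece I d : I 0 ->
  (forall a f g, I f -> I g -> I (a *: f + g)) ->
  forall f : dhomog 3 F d, f \in graded_piece I d <-> I (mpoly_of_dhomog f).
Proof.
move=> I0 IZD; rewrite /graded_piece.
case: xgetP => [U _ //| noU].
pose inI (U : {vspace dhomog 3 F d}) := forall f : dhomog 3 F d, f \in U -> I (mpoly_of_dhomog f).
pose has_dim k := `[< exists2 U : {vspace dhomog 3 F d}, inI U & \dim U = k >].
have ex0 : exists k, has_dim k.
  exists 0%N; apply/asboolP; exists 0%VS; last by rewrite dimv0.
  by move=> f; rewrite memv0 => /eqP ->.
have le_dim k : has_dim k -> (k <= \dim {: dhomog 3 F d})%N.
  by case/asboolP => U _ <-; apply/dimvS/subvf.
case: (ex_maxnP ex0 le_dim) => k /asboolP[U UI Uk] maxk.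
case: (noU U) => f; split=> [/UI //|If].
have /maxk : has_dim (\dim (U + <[f]>)).
  apply/asboolP; exists (U + <[f]>)%VS => // g /memv_addP[u uU [w /vlineP[a ->] ->]].
  by rewrite addrC; exact: (IZD a f u If (UI _ uU)).
rewrite -Uk => le_U; have : (U == U + <[f]>)%VS by rewrite eqEdim addvSl.
by move/eqP->; apply: subvP (addvSr _ _) _ (memv_line _).
Qed.

Definition hilbert_function I (d : nat) : nat :=
  (\dim {: dhomog 3 F d} - \dim (graded_piece I d))%N.

Definition h_vector I (d : nat) : int :=
  (hilbert_function I d)%:Z -
  (if d is e.+1 then (hilbert_function I e)%:Z else 0).

End Forms.

Definition written_as (h : nat -> int) (a : seq nat) : Prop :=
  (forall d, h d = (nth 0%N a d)%:Z) /\ last 1%N a != 0%N.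

(* Main.v *)
Require Import Defs.
From HB Require Import structures.
From mathcomp Require Import all_boot all_order all_algebra zify ring.
From mathcomp Require Import boolp classical_sets reals complex mpoly.

(* Proof idea. Attach to a point the two parameters [a], [b] of the tangents to
   the conic passing through it. A form [f] of degree [d] then becomes the
   alternating polynomial [(a - b) f(a, b)] of degree at most [d + 1] in each
   variable, every such polynomial arises in this way, and vanishing on a star
   means vanishing at all pairs of parameters of its tangents. If [t <= d + 2],
   Lagrange interpolation at the [t] parameters of the largest star and
   [e = d + 2 - t] parameters of another one shows that the vanishing of [f] on
   the largest star and at the pairs [(i, j)], [i < j], [i < e], of each other
   star forces its vanishing on all the stars; products of linear factors show
   that these conditions are independent as soon as [r + s <= t + 1]. If
   [d + 2 < t], the pairs among [d + 2] tangents of the largest star suffice. So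
   the Hilbert function is a number of pairs. For the fat points, in coordinates
   where they are the coordinate points, the ideal is monomial, and counting the
   monomials outside it gives the same number. *)

Set Implicit Arguments.
Unset Strict Implicit.
Unset Printing Implicit Defensive.

Import Order.TTheory GRing.Theory Num.Theory.

(** * Independent linear conditions *)

Section LinearConditions.
Local Open Scope ring_scope.

(** Ordered by [rk], the matrix of the values [ev y (g x)] is triangular with nonzero diagonal.
    Hence the joint evaluation on [A] is onto, and its kernel [U] has codimension [#|A|]. *)
Lemma dim_zeros_triangular (F : fieldType) (V : vectType F) (T : finType)
    (ev : T -> {scalar V}) (A : {set T}) (U : {vspace V})
    (rk : T -> nat) (g : T -> V) :
  (forall v, (v \in U) = [forall x in A, ev x v == 0]) ->
  (forall x, x \in A -> ev x (g x) != 0) ->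
  (forall x y, x \in A -> y \in A -> y != x -> ev y (g x) != 0 -> (rk y < rk x)%N) ->
  (\dim {: V} - \dim U)%N = #|A|.
Proof.
move=> memU evg0 evg.
pose phi v := \row_(i < #|A|) ev (enum_val i) v.
have phi_lin : linear phi.
  by move=> a u v; apply/rowP=> i; rewrite !mxE linearP.
pose phiL : {linear V -> 'rV[F]_#|A|} :=
  HB.pack phi (GRing.isLinear.Build F V 'rV[F]_#|A| *:%R phi phi_lin).
pose h := linfun phiL.
have -> : U = lker h.
  apply/vspaceP => v; rewrite memU memv_ker lfunE /=.
  apply/forall_inP/eqP => [v0 | v0 x xA].
    by apply/rowP=> i; rewrite !mxE; apply/eqP/v0/enum_valP.
  by move/rowP: v0 => /(_ (enum_rank_in xA x)); rewrite !mxE enum_rankK_in // => ->.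
rewrite -(limg_ker_dim h {: V}) capfv addKn.
have -> : (h @: {:V})%VS = fullv; last by rewrite dimvf /dim /= mul1n.
pose M := \matrix_(i < #|A|) phi (g (enum_val i)).
have freeM : row_free M^T.
  apply/inj_row_free => v vM0; apply/rowP=> i; rewrite !mxE.
  have {}vM0 x (xA : x \in A) : \sum_(i < #|A|) v 0 i * ev (enum_val i) (g x) = 0.
    move/rowP: vM0 => /(_ (enum_rank_in xA x)); rewrite !mxE => vM0.
    rewrite -[RHS]vM0; apply: eq_bigr => j _.
    by rewrite !mxE enum_rankK_in.
  (* In the relation tested on [g x], only conditions of smaller rank occur besides [x] itself, and
     their coefficients vanish by induction. *)
  have [k] := ubnP (rk (enum_val i)); elim: k i => // k IHk i; rewrite ltnS => rki.
  have := vM0 _ (enum_valP i); rewrite (bigD1 i) //= big1 => [|j ji].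
    by move/eqP; rewrite addr0 mulf_eq0 (negPf (evg0 _ (enum_valP i))) orbF => /eqP.
  have [-> |nz] := eqVneq (ev (enum_val j) (g (enum_val i))) 0; first by rewrite mulr0.
  rewrite IHk ?mul0r //; apply: leq_trans rki.
  by apply: evg nz; rewrite ?enum_valP // (inj_eq enum_val_inj).
apply/eqP; rewrite eqEsubv subvf; apply/subvP => w _.
have Munit : M \in unitmx by rewrite -unitmx_tr -row_free_unit.
apply/memv_imgP; exists (\sum_i (w *m invmx M) 0 i *: g (enum_val i)); first exact: memvf.
rewrite lfunE linear_sum.
rewrite -[LHS](mulmxKV Munit) mulmx_sum_row; apply: eq_bigr => i _.
by rewrite linearZ rowK.
Qed.

End LinearConditions.

(** * Counting *)

Section Counting.
Implicit Types (r s t d e m n : nat).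

(** The pairs among the first [d.+2] tangents of the largest star, then row by row the pairs
    [(i, j)] of the two others; truncated subtraction makes the rows past the end contribute 0. *)
Definition hilbert_value t r s d : nat :=
  'C(minn t d.+2, 2) + \sum_(i < d.+2 - t) ((r - 1 - i) + (s - 1 - i)).

Lemma sum_ord_lt n m : \sum_(i < n) (i < m : nat) = minn n m.
Proof.
elim: n => [|n IH]; first by rewrite big_ord0 min0n.
by rewrite big_ord_recr /= IH; lia.
Qed.

Lemma sum_ord_gt n m : \sum_(i < n) (m < i : nat) = n - m.+1.
Proof.
elim: n => [|n IH]; first by rewrite big_ord0.
by rewrite big_ord_recr /= IH; lia.
Qed.

Lemma card_ord_pairs t m :
  \sum_(i < t) \sum_(j < t) ((i < j) && (j < m) : nat) = 'C(minn t m, 2).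
Proof.
rewrite exchange_big /=.
have -> : \sum_(j < t) \sum_(i < t) ((i < j) && (j < m) : nat)
    = \sum_(j < t) (j < m : nat) * j.
  apply: eq_bigr => j _; case: (j < m); last by rewrite big1 // => i _; rewrite andbF.
  under eq_bigr => i _ do rewrite andbT.
  by rewrite sum_ord_lt mul1n (minn_idPr (ltnW (ltn_ord j))).
elim: t => [|t IH]; first by rewrite big_ord0 min0n.
rewrite big_ord_recr /= IH; case: (ltnP t m) => tm.
  have -> : minn t.+1 m = t.+1 by lia.
  by rewrite binS bin1 mul1n addnC.
by rewrite mul0n addn0; congr 'C(_, 2); lia.
Qed.

Lemma sum_ord_cut r e (f : nat -> nat) : (forall i, r <= i -> f i = 0) ->
  \sum_(i < r) (i < e : nat) * f i = \sum_(i < e) f i.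
Proof.
move=> f0.
rewrite (@big_ord_widen _ _ _ r (maxn r e) (fun i => (i < e : nat) * f i)) ?leq_maxl //.
rewrite (@big_ord_widen _ _ _ e (maxn r e)) ?leq_maxr //.
rewrite big_mkcond [RHS]big_mkcond; apply: eq_bigr => i _ /=.
case: (ltnP i e) => ie; case: ltnP => ir; rewrite ?mul1n ?mul0n //.
by rewrite f0.
Qed.

Lemma card_low_pairs r e :
  \sum_(i < r) \sum_(j < r) ((i < j) && (i < e) : nat) = \sum_(i < e) (r - 1 - i).
Proof.
rewrite -(@sum_ord_cut r e (fun i => r - 1 - i)); last by move=> i; lia.
apply: eq_bigr => i _; case: (i < e); last by rewrite big1 // => j _; rewrite andbF.
under eq_bigr => j _ do rewrite andbT.
by rewrite sum_ord_gt mul1n; lia.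
Qed.

Lemma sum_triangle t d : 0 < t ->
  \sum_(d.+2 - t <= i < d.+1) (d - i).+1 = 'C(minn t d.+2, 2).
Proof.
move=> t0; have -> : minn t d.+2 = (d.+2 - (d.+2 - t)) by lia.
have : d.+2 - t <= d.+1 by lia.
move: (d.+2 - t) => e; rewrite -[e <= _]ltnS => ed.
have [k kE] : exists k, k + e = d.+1 by exists (d.+1 - e); lia.
elim: k e {ed} kE => [|k IH] e kE.
  by rewrite big_geq; [have -> : d.+2 - e = 1 by lia | lia].
rewrite big_ltn ?IH; [|lia|lia].
have -> : d.+2 - e = (d - e).+2 by lia.
have -> : d.+2 - e.+1 = (d - e).+1 by lia.
by rewrite [RHS]binS bin1 addnC.
Qed.

(** The monomial with exponents [a], [b], [d - a - b] has orders [d - a], [d - b], [a + b] at the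
    three coordinate points; it is bad if one of them falls short of the multiplicity there. *)
Definition bad_monomial t r s d (a b : nat) : bool :=
  (a + b <= d) && [|| d - a < t - 1, d - b < r - 1 | a + b < s - 1].

(** The rows with [d - a < t - 1] are bad throughout and add up to the binomial coefficient. In the
    other rows, [r + s <= t.+1] makes the two remaining ranges of bad [b] disjoint. *)
Lemma card_bad_monomials t r s d : 0 < t -> 0 < r -> r + s <= t.+1 ->
  \sum_(a < d.+1) \sum_(b < d.+1) (bad_monomial t r s d a b : nat) = hilbert_value t r s d.
Proof.
move=> t0 r0 rst.
have row (a : nat) : a < d.+1 -> \sum_(b < d.+1) (bad_monomial t r s d a b : nat)
    = if d - a < t - 1 then (d - a).+1 else (r - 1 - a) + (s - 1 - a).
  rewrite ltnS => ad; case: ifP => dat.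
    under eq_bigr => b _.
      rewrite (_ : nat_of_bool _ = (b < (d - a).+1)); last first.
        by rewrite /bad_monomial dat andbT; congr nat_of_bool; lia.
      over.
    by rewrite sum_ord_lt; lia.
  (* The added term counts the [b] that pass the second test. As no [b] fails both the second and
     the third, the sum becomes that of the indicators of two initial segments. *)
  apply/eqP; rewrite -(eqn_add2r (minn d.+1 (minn (d.+2 - r) (d.+1 - a)))).
  rewrite -sum_ord_lt -big_split /=.
  under eq_bigr => b _.
    rewrite (_ : _ + _ = (b < s - 1 - a : nat) + (b < d.+1 - a)); last first.
      by rewrite /bad_monomial dat /=; have := ltn_ord b; lia.
    over.
  by rewrite big_split /= !sum_ord_lt; lia.
rewrite (eq_bigr _ (fun (a : 'I_d.+1) _ => row a (ltn_ord a))).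
rewrite -(big_mkord xpredT (fun a => if d - a < t - 1 then (d - a).+1
  else (r - 1 - a) + (s - 1 - a))).
rewrite (@big_cat_nat _ _ _ (d.+2 - t)) //=; last by lia.
rewrite addnC /hilbert_value -sum_triangle //; congr (_ + _).
  by apply: eq_big_nat => i /andP[i1 i2]; rewrite (_ : _ < _ = true) //; lia.
rewrite -(big_mkord xpredT (fun i => (r - 1 - i) + (s - 1 - i))).
by apply: eq_big_nat => i /andP[_ i2]; rewrite (_ : _ < _ = false) //; lia.
Qed.

Lemma hilbert_value_low t r s d : d.+2 <= t ->
  hilbert_value t r s d = 'C(d.+2, 2).
Proof.
move=> dt; rewrite /hilbert_value (_ : d.+2 - t = 0) ?big_ord0 ?addn0; last by lia.
by rewrite (minn_idPr dt).
Qed.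

Lemma hilbert_value_step t r s d : t <= d.+2 ->
  hilbert_value t r s d.+1 = hilbert_value t r s d
    + ((r - 1 - (d.+2 - t)) + (s - 1 - (d.+2 - t))).
Proof.
move=> td; rewrite /hilbert_value !(minn_idPl _) //; last exact: leqW.
by rewrite (subSn td) big_ord_recr /= addnA.
Qed.

Definition expected_h t r s : seq nat :=
  iota 1 (t - 1)
  ++ [seq r + s - 2 - 2 * i | i <- iota 0 (s - 1)]
  ++ [seq r - s - i | i <- iota 0 (r - s)].

(** The two descending groups are one formula in [i = d.+1 - t]: from [i = s - 1] on, [s - 1 - i]
    truncates to 0 and the steps of two become steps of one. *)
Lemma nth_expected_h t r s d : 0 < t -> 0 < s -> s <= r ->
  nth 0 (expected_h t r s) d = if d.+1 < t then d.+1
    else (r - 1 - (d.+1 - t)) + (s - 1 - (d.+1 - t)).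
Proof.
move=> t0 s0 sr; rewrite /expected_h !nth_cat size_iota !size_map !size_iota.
have -> : (d < t - 1) = (d.+1 < t) by lia.
case: ifP => dt; first by rewrite nth_iota; lia.
case: ifP => ds; first by rewrite (nth_map 0) ?size_iota // nth_iota //; lia.
case: (ltnP (d - (t - 1) - (s - 1)) (r - s)) => dr.
  by rewrite (nth_map 0) ?size_iota // nth_iota //; lia.
by rewrite nth_default ?size_map ?size_iota //; lia.
Qed.

Lemma last_expected_h t r s : 2 <= s -> s <= r -> last 1 (expected_h t r s) != 0.
Proof.
move=> s2 sr; rewrite /expected_h !last_cat; case: (ltnP s r) => lsr.
  have -> : r - s = (r - s - 1) + 1 by lia.
  by rewrite iotaD map_cat last_cat /=; lia.
have -> : r - s = 0 by lia.
have -> : s - 1 = (s - 2) + 1 by lia.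
by rewrite iotaD map_cat !last_cat /=; lia.
Qed.

End Counting.

(** * Alternating polynomials at pairs of parameters *)

Section Nodal.
Local Open Scope ring_scope.

Variables (F : fieldType) (K : finType) (z : K -> F).
Hypothesis z_inj : injective z.
Implicit Types (N : {set K}) (x : K).

Definition nodal N : {poly F} := \prod_(x in N) ('X - (z x)%:P).

Lemma size_nodal N : size (nodal N) = #|N|.+1.
Proof.
rewrite /nodal -big_filter size_prod_XsubC.
by have [e _ _ [_ ->]] := big_enumP.
Qed.

Lemma nodal_eq0 N x : ((nodal N).[z x] == 0) = (x \in N).
Proof.
rewrite horner_prod; apply/prodf_eq0/idP => [[y yN]|xN].
  by rewrite !hornerE subr_eq0 (inj_eq z_inj) => /eqP->.
by exists x; rewrite // !hornerE subrr.
Qed.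

(** The coefficients [L] do not depend on [p], so that one choice serves in one variable of a
    function for all values of the other. *)
Lemma lagrange_interpolation N (n : nat) (a : F) : (n <= #|N|)%N ->
  exists L : K -> F, forall p : {poly F}, (size p <= n)%N ->
    p.[a] = \sum_(x in N) L x * p.[z x].
Proof.
move=> nN; pose l x := nodal (N :\ x).
exists (fun x => (l x).[a] / (l x).[z x]) => p szp.
pose q := \sum_(x in N) (p.[z x] / (l x).[z x]) *: l x.
have lE x y : y \in N -> y != x -> (l x).[z y] = 0.
  by move=> yN yx; apply/eqP; rewrite nodal_eq0 !inE yx.
have lx0 x : (l x).[z x] != 0 by rewrite nodal_eq0 !inE eqxx.
suff pq : p = q.
  rewrite {1}pq horner_sum; apply: eq_bigr => x xN.
  by rewrite hornerZ mulrAC [RHS]mulrAC [p.[_] * _]mulrC.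
apply/eqP; rewrite -subr_eq0; apply/eqP.
apply: (@roots_geq_poly_eq0 F _ [seq z x | x <- enum N]).
- apply/allP => a0 /mapP[x xN ->]; move: xN; rewrite mem_enum => xN.
  rewrite /root hornerD hornerN horner_sum (bigD1 x) //= big1 => [|y /andP[yN yx]].
    by rewrite hornerZ divfK // addr0 subrr.
  by rewrite hornerZ [(l y).[z x]]lE ?mulr0 // eq_sym.
- by rewrite map_inj_uniq // enum_uniq.
rewrite size_map -cardE; apply: leq_trans (size_polyD _ _) _.
rewrite size_polyN geq_max (leq_trans szp nN) /=.
apply: (leq_trans (size_sum _ _ _)); apply/bigmax_leqP => x xN.
apply: leq_trans (size_scale_leq _ _) _.
by rewrite size_nodal (cardsD1 x N) xN.
Qed.

End Nodal.

(** * Pairs of tangents that span, and are independent of one another *)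

Section ContactPairs.
Local Open Scope ring_scope.

Variables (F : fieldType) (K : finType) (C : eqType).
Variables (z : K -> F) (cl : K -> C) (pos : K -> nat) (w : C) (sz : C -> nat).
Variable d : nat.
Hypothesis z_inj : injective z.
Hypothesis pos_inj : forall x y, cl x = cl y -> pos x = pos y -> x = y.
Hypothesis card_pos : forall c m,
  #|[set x | (cl x == c) && (pos x < m)%N]| = minn m (sz c).
Hypothesis card_small : (#|[set x | cl x != w]| <= (sz w).+1)%N.

(* [cl] tells to which star a tangent belongs, [pos] its index there, and [w] is
   the largest star. *)
Definition basic_pairs : {set K * K} :=
  [set p | [&& cl p.1 == cl p.2, (pos p.1 < pos p.2)%N
    & if cl p.1 == w then (pos p.2 < d.+2)%N else (pos p.1 < d.+2 - sz w)%N]].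

(** A polynomial of size at most [d.+2] is determined by its values at [d.+2] nodes. These are taken
    in [w] and, if [w] is too small, completed by the first tangents of the star of [x]. *)
Lemma basic_pairs_span (G : F -> F -> F) :
  (forall b, exists2 p : {poly F}, (size p <= d.+2)%N & forall a, G a b = p.[a]) ->
  (forall a b, G a b = - G b a) -> (forall a, G a a = 0) ->
  (forall x, x \in basic_pairs -> G (z x.1) (z x.2) = 0) ->
  forall x y, cl x = cl y -> G (z x) (z y) = 0.
Proof.
move=> Gpoly Ganti Gdiag Gbasic.
pose e := (d.+2 - sz w)%N.
have Gb x y : cl x = cl y -> (pos x < pos y)%N ->
    (if cl x == w then (pos y < d.+2)%N else (pos x < e)%N) -> G (z x) (z y) = 0.
  by move=> cxy lxy b; apply: (Gbasic (x, y)); rewrite inE /= cxy eqxx lxy /= -cxy.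
(* Antisymmetry and vanishing on the diagonal remove the condition on the order of the two
   positions. *)
have Gb' x y : cl x = cl y -> (if cl x == w then (pos x < d.+2) && (pos y < d.+2)
    else (pos x < e) || (pos y < e))%N -> G (z x) (z y) = 0.
  move=> cxy b; case: (ltngtP (pos x) (pos y)) => [lt|lt|eqp].
  - apply: Gb => //; move: b; case: ifP => _; first by case/andP.
    by case/orP => // /(ltn_trans lt).
  - rewrite Ganti Gb ?oppr0 //; move: b; rewrite cxy; case: ifP => _.
      by case/andP.
    by case/orP => // /(ltn_trans lt).
  by rewrite (pos_inj cxy eqp) Gdiag.
move=> x y cxy.
pose NW := [set u | (cl u == w) && (pos u < d.+2)%N].
pose NC := [set u | (cl u == cl x) && (pos u < e)%N].
have [|nbasic] := boolP (if cl x == w then (pos x < d.+2) && (pos y < d.+2)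
    else (pos x < e) || (pos y < e))%N; first exact: Gb'.
(* Positions fill an initial segment: if the star had fewer than [m] members, raising the bound from
   [m] to include [u] would add nothing. *)
have lt_card c u m : cl u = c -> ~~ (pos u < m)%N -> (m <= sz c)%N.
  move=> cu; apply: contraNT; rewrite -ltnNge => ltm.
  have := card_pos c m; rewrite (minn_idPr (ltnW ltm)) => cm.
  have := card_pos c (maxn m (pos u).+1); rewrite (minn_idPr _); last first.
    by apply: leq_trans (ltnW ltm) (leq_maxl _ _).
  rewrite -cm => /eqP; rewrite eq_sym => /eqP eqc.
  have /finset.setP/(_ u) : [set v | (cl v == c) && (pos v < m)%N]
      = [set v | (cl v == c) && (pos v < maxn m (pos u).+1)%N].
    apply/eqP; rewrite eqEcard eqc leqnn andbT; apply/fintype.subsetP => v.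
    by rewrite !inE => /andP[-> /leq_trans]; apply; rewrite leq_maxl.
  by rewrite !inE cu eqxx /= leq_max leqnn orbT => ->.
(* For a pair that [Gb'] does not cover, the star of [x] has at least [e] members; if that star is
   [w], it has at least [d.+2], so that [e = 0] and [NC] is empty. *)
have NWNC : (d.+2 <= #|NW :|: NC|)%N /\ [disjoint NW & NC].
  have e0 : cl x == w -> e = 0%N.
    move=> xw; move: nbasic; rewrite xw negb_and => b.
    have : (d.+2 <= sz w)%N.
      by case/orP: b; apply: lt_card; rewrite -?cxy; apply/eqP.
    by rewrite -subn_eq0 => /eqP.
  have dis : [disjoint NW & NC].
    rewrite -finset.setI_eq0; apply/eqP/finset.setP => u; rewrite !inE.
    apply/negP => /andP[/andP[/eqP-> _] /andP[/eqP xw]].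
    by rewrite e0 // -xw.
  split=> //; have := cardsUI NW NC.
  have /eqP -> : NW :&: NC == finset.set0 by rewrite finset.setI_eq0.
  rewrite cards0 addn0 => ->.
  rewrite !card_pos; have [xw|xw] := boolP (cl x == w); first by move: (e0 xw); rewrite /e; lia.
  move: nbasic; rewrite (negPf xw) negb_or => /andP[b _].
  by have := lt_card _ _ _ (erefl (cl x)) b; rewrite /e; lia.
have [cardN disN] := NWNC.
have [Lx LxP] := lagrange_interpolation z_inj (z x) cardN.
have [Ly LyP] := lagrange_interpolation z_inj (z y) cardN.
have Gx b : G (z x) b = \sum_(u in NW) Lx u * G (z u) b + \sum_(u in NC) Lx u * G (z u) b.
  have [p szp pE] := Gpoly b.
  rewrite pE LxP // (eq_bigl _ _ (fun u => finset.in_setU u NW NC)) bigU //=.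
  by congr (_ + _); apply: eq_bigr => u _; rewrite pE.
have Gy a : G a (z y) = \sum_(u in NW) Ly u * G a (z u) + \sum_(u in NC) Ly u * G a (z u).
  have [p szp pE] := Gpoly a.
  rewrite Ganti pE LyP // (eq_bigl _ _ (fun u => finset.in_setU u NW NC)) bigU //= opprD -!sumrN.
  by congr (_ + _); apply: eq_bigr => u _; rewrite [in RHS]Ganti pE mulrN.
have NCb u v : u \in NC -> cl v = cl x -> G (z u) (z v) = 0.
  rewrite inE => /andP[/eqP ux ue] vx; apply: Gb'; first by rewrite ux.
  rewrite ux ue /=; case: ifP => // xw; move: ue; rewrite /e => ue.
  move: nbasic; rewrite xw negb_and => /orP b.
  have : (d.+2 <= sz w)%N.
    by case: b; apply: lt_card; rewrite -?cxy; apply/eqP.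
  by move: ue; lia.
have NCW u v : u \in NW -> v \in NW -> G (z u) (z v) = 0.
  rewrite !inE => /andP[/eqP uw ud] /andP[/eqP vw vd].
  by apply: Gb'; rewrite ?uw ?vw // eqxx ud vd.
(* The functionals [p(z x) - sum over NC of Lx u * p(z u)] and its analogue for
   [y] are combinations of the values on [NW]; apply them to the two variables of
   [G], which vanishes on [NW * NW], on [NC * NC] and on [NC * {x, y}]. *)
pose g b := \sum_(u in NW) Lx u * G (z u) b.
have gE b : cl b = cl x -> G (z x) (z b) = g (z b).
  by move=> bx; rewrite Gx [X in _ + X]big1 ?addr0 // => u /NCb->; rewrite ?mulr0.
have gNC u : u \in NC -> g (z u) = 0.
  move=> uN; rewrite -gE; first by rewrite Ganti (NCb u x) ?oppr0.
  by move: uN; rewrite inE => /andP[/eqP].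
rewrite gE //; rewrite /g.
under eq_bigr => u uNW.
  rewrite Gy [X in X + _]big1 ?add0r; last by move=> v vN; rewrite NCW ?mulr0.
  over.
under eq_bigr => u _ do rewrite mulr_sumr.
rewrite exchange_big big1 //= => u /gNC g0.
by under eq_bigr => v _ do rewrite mulrCA; rewrite -mulr_sumr -/(g _) g0 mulr0.
Qed.

(* The polynomials separating a pair [(k, l)] with both entries below the
   threshold need not vanish at the pairs [(l, j)] with [j] above it, and those
   separating a pair of the star [w] need not vanish on the other stars. *)
Definition pair_rank (x : K * K) : nat :=
  if cl x.1 == w then 2%N else (pos x.2 < d.+2 - sz w)%N.

(** For a pair [(k, l)] of [w], nodal polynomials omitting [k] and [l] respectively leave no other
    basic pair of [w]. Outside [w], the first kills [w] and the low tangents of the star other than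
    [k], the second all tangents outside [w] other than [l]. A surviving pair then contains [l]: it
    is [(k, l)], or [(l, j)] with [j] above the threshold, of lower rank. *)
Lemma basic_pairs_separated x : x \in basic_pairs ->
  exists P Q : {poly F}, [/\ (size P <= d.+2)%N, (size Q <= d.+2)%N,
    P.[z x.1] * Q.[z x.2] - P.[z x.2] * Q.[z x.1] != 0
    & forall y, y \in basic_pairs -> y != x ->
      P.[z y.1] * Q.[z y.2] - P.[z y.2] * Q.[z y.1] != 0 ->
      (pair_rank y < pair_rank x)%N].
Proof.
case: x => k l; rewrite inE /= => /and3P[/eqP ckl lkl].
have kl : k != l by apply: contraTneq lkl => ->; rewrite ltnn.
pose NW := [set u | (cl u == w) && (pos u < d.+2)%N].
have cardW : (#|NW| <= d.+2)%N by rewrite card_pos geq_minl.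
have [kw ld|kw ke] := boolP (cl k == w).
  have kN : k \in NW by rewrite inE kw (ltn_trans lkl).
  have lN : l \in NW by rewrite inE -ckl kw.
  exists (nodal z (NW :\ k)), (nodal z (NW :\ l)); split=> /=.
  - by rewrite size_nodal; move: cardW; rewrite (cardsD1 k) kN.
  - by rewrite size_nodal; move: cardW; rewrite (cardsD1 l) lN.
  - have /eqP-> : (nodal z (NW :\ k)).[z l] == 0.
      by rewrite nodal_eq0 // finset.in_setD1 eq_sym kl lN.
    by rewrite mul0r subr0 mulf_neq0 // nodal_eq0 // finset.in_setD1 eqxx.
  case=> i j; rewrite inE /= => /and3P[/eqP cij lij].
  rewrite /pair_rank /= kw; case: ifP => [iw jd neq|_ _ _ _]; last by rewrite ltnS leq_b1.
  have iN : i \in NW by rewrite inE iw (ltn_trans lij).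
  have jN : j \in NW by rewrite inE -cij iw.
  have van u v : u \in NW -> v \in NW -> (u, v) != (k, l) ->
      (nodal z (NW :\ k)).[z u] * (nodal z (NW :\ l)).[z v] = 0.
    move=> uN vN uv; apply/eqP; rewrite mulf_eq0 !nodal_eq0 // !finset.in_setD1 uN vN.
    by rewrite !andbT -negb_and; apply: contraNN uv => /andP[/eqP-> /eqP->].
  rewrite van // [X in _ - X]mulrC [X in _ - X]mulrC van ?subr0 ?eqxx //.
  by apply/eqP=> -[jk il]; move: lij lkl; rewrite -jk -il; lia.
pose e := (d.+2 - sz w)%N.
pose NC := [set u | (cl u == cl k) && (pos u < e)%N].
(* Both sets have at most [d.+1] elements: [N1] because [NC] has at most [d.+2 - sz w] and loses
   [k], [N2] because [card_small] leaves at most [sz w] once [l] is removed. *)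
pose N1 := NW :|: (NC :\ k); pose N2 := [set u | cl u != w] :\ l.
have kN : k \in NC by rewrite inE eqxx.
have wd : (sz w <= d.+1)%N by lia.
exists (nodal z N1), (nodal z N2).
have N1k : k \notin N1 by rewrite !inE (negPf kw) eqxx.
have N2l : l \notin N2 by rewrite !inE eqxx.
have N2k : k \in N2 by rewrite !inE kl kw.
split.
- rewrite size_nodal; have := card_pos (cl k) e; rewrite (cardsD1 k) -/NC kN.
  have := card_pos w d.+2; have := cardsU NW (NC :\ k); rewrite /N1 -/NW; lia.
- rewrite size_nodal; move: card_small; rewrite (cardsD1 l) inE -ckl kw.
  by move=> h; apply: leq_trans h _.
- have /eqP-> : (nodal z N2).[z k] == 0 by rewrite nodal_eq0.
  by rewrite mulr0 subr0 mulf_neq0 // nodal_eq0.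
case=> i j; rewrite inE /= => /and3P[/eqP cij lij].
rewrite /pair_rank /= (negPf kw); case: ifP => [iw jd neq|iw ie neq].
  have iN : i \in N1 by rewrite !inE iw (ltn_trans lij).
  have jN : j \in N1 by rewrite !inE -cij iw jd.
  have /eqP-> : (nodal z N1).[z i] == 0 by rewrite nodal_eq0.
  have /eqP-> : (nodal z N1).[z j] == 0 by rewrite nodal_eq0.
  by rewrite !mul0r subr0 eqxx.
have cN2 u : cl u = cl i -> u != l -> (nodal z N2).[z u] = 0.
  by move=> ui ul; apply/eqP; rewrite nodal_eq0 // !inE ul ui iw.
have [jl|jl] := eqVneq j l.
  have il : i != l by apply: contraTneq lij => ->; rewrite jl ltnn.
  rewrite (cN2 i) // mulr0 subr0; have /eqP-> : (nodal z N1).[z i] == 0.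
    rewrite nodal_eq0 // !inE cij jl ckl eqxx ie !andbT.
    by apply/orP; right; apply: contraNN neq => /eqP->; rewrite jl.
  by rewrite mul0r eqxx.
rewrite (cN2 j) // mulr0 sub0r oppr_eq0.
have [il|il] := eqVneq i l; last by rewrite cN2 ?mulr0 ?eqxx.
rewrite -il in lkl *; rewrite ie.
have [je|//] := boolP (pos j < e)%N.
have /eqP-> : (nodal z N1).[z j] == 0; last by rewrite mul0r eqxx.
rewrite nodal_eq0 // !inE -cij il -ckl eqxx je !andbT; apply/orP; right.
by apply: contraTneq lij => ->; rewrite -leqNgt ltnW // -il.
Qed.

End ContactPairs.

(** * Forms in the coordinates given by two tangents *)

Section LinearChange.
Local Open Scope ring_scope.

Variables (F : fieldType) (n : nat).
Implicit Types (M N : 'M[F]_n) (f g : {mpoly F[n]}).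

(** Points being row vectors, this is [f] composed with [v |-> v *m M]. *)
Definition mx_comp M f : {mpoly F[n]} :=
  f \mPo [tuple \sum_(j < n) M j i *: 'X_j | i < n].

HB.instance Definition _ M := GRing.RMorphism.copy (mx_comp M)
  (comp_mpoly [tuple \sum_(j < n) M j i *: 'X_j | i < n]).
HB.instance Definition _ M := GRing.Linear.copy (mx_comp M)
  (comp_mpoly [tuple \sum_(j < n) M j i *: 'X_j | i < n]).

Lemma mx_comp_sum M (T : Type) (s : seq T) (h : T -> {mpoly F[n]}) :
  mx_comp M (\sum_(x <- s) h x) = \sum_(x <- s) mx_comp M (h x).
Proof. exact: raddf_sum. Qed.

Lemma mx_compM M f g : mx_comp M (f * g) = mx_comp M f * mx_comp M g.
Proof. exact: rmorphM. Qed.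

Lemma mx_comp_prod M (T : Type) (s : seq T) (h : T -> {mpoly F[n]}) :
  mx_comp M (\prod_(x <- s) h x) = \prod_(x <- s) mx_comp M (h x).
Proof. exact: rmorph_prod. Qed.

Lemma mx_compXU M i : mx_comp M 'X_i = \sum_(j < n) M j i *: 'X_j.
Proof. by rewrite /mx_comp comp_mpolyXU -tnth_nth tnth_mktuple. Qed.

Lemma mx_compX M m : mx_comp M 'X_[m] = \prod_(i < n) (mx_comp M 'X_i) ^+ m i.
Proof.
by rewrite {1}/mx_comp comp_mpolyX; apply: eq_bigr => i _; rewrite mx_compXU tnth_mktuple.
Qed.

Lemma mx_compE M f : mx_comp M f = \sum_(m <- msupp f) f@_m *: mx_comp M 'X_[m].
Proof. exact: comp_mpolyEX. Qed.

Lemma meval_mx_comp M f (v : 'rV_n) : (mx_comp M f).@[v 0] = f.@[(v *m M) 0].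
Proof.
rewrite /mx_comp comp_mpoly_meval; apply: meval_eq => i.
rewrite tnth_mktuple !mxE raddf_sum; apply: eq_bigr => j _ /=.
by rewrite mevalZ mevalXU mulrC.
Qed.

Lemma mx_compA M N f : mx_comp M (mx_comp N f) = mx_comp (M *m N) f.
Proof.
rewrite [mx_comp N f]mx_compE linear_sum [RHS]mx_compE; apply: eq_bigr => m _.
rewrite linearZ; congr (_ *: _); rewrite !(mx_compX, rmorph_prod).
apply: eq_bigr => i _; rewrite (rmorphXn (mx_comp M)); congr (_ ^+ _).
rewrite !mx_compXU (raddf_sum (mx_comp M)).
under eq_bigr => j _ do rewrite /= linearZ /= mx_compXU scaler_sumr.
rewrite exchange_big; apply: eq_bigr => j _ /=.
by rewrite mxE scaler_suml; apply: eq_bigr => k _; rewrite scalerA mulrC.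
Qed.

Lemma mx_comp1 f : mx_comp 1%:M f = f.
Proof.
rewrite -[RHS]comp_mpoly_id /mx_comp; congr (_ \mPo _); apply: eq_mktuple => i.
rewrite (bigD1 i) //= mxE eqxx scale1r big1 ?addr0 // => j ji.
by rewrite mxE (negPf ji) scale0r.
Qed.

Lemma mx_comp_dhomog M d f : f \is d.-homog -> mx_comp M f \is d.-homog.
Proof.
move=> /dhomogP fd; rewrite mx_compE big_seq rpred_sum // => m /fd <-.
rewrite rpredZ //= mx_compX mdegE.
elim/big_rec2: _ => [|i e g _ ge]; first exact: dhomog1.
have Mi1 : mx_comp M 'X_i \is 1.-homog.
  by rewrite mx_compXU rpred_sum // => j _; rewrite rpredZ // dhomogX /= mdeg1.
by apply: dhomogM ge; have := dhomogMn (m i) Mi1; rewrite mul1n.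
Qed.

End LinearChange.

(** * Forms as alternating polynomials in two parameters *)

Section Secants.
Local Open Scope ring_scope.

Variable F : fieldType.
Implicit Types (E : 'M[F]_3) (a b : F) (f : {mpoly F[3]}).

(* The intersection of the tangent lines with parameters [a] and [b] to the
   conic [a |-> secant E a a]. *)
Definition secant E a b : 'rV[F]_3 := (\row_i [:: 1; a + b; a * b]`_i) *m E.

Lemma secantC E a b : secant E a b = secant E b a.
Proof. by rewrite /secant [a + b]addrC [a * b]mulrC. Qed.

(** For fixed [b] the coordinates of [secant E a b] are affine in [a], so that [f] has degree at
    most [d] in [a], and the factor [a - b] adds one. *)
Lemma secant_form_poly E f d b : f \is d.-homog ->
  exists2 p : {poly F}, (size p <= d.+2)%N
    & forall a, (a - b) * f.@[secant E a b 0] = p.[a].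
Proof.
move=> /dhomogP fd.
pose c i : {poly F} := (E 0 i + b * E 1 i)%:P + (E 1 i + b * E (2%:R) i) *: 'X.
have szc i : (size (c i) <= 2)%N.
  rewrite (leq_trans (size_polyD _ _)) // geq_max (leq_trans (size_polyC_leq1 _)) //.
  by rewrite (leq_trans (size_scale_leq _ _)) ?size_polyX.
have cE a i : (c i).[a] = secant E a b 0 i.
  rewrite !hornerE mxE !big_ord_recl big_ord0 !mxE /=.
  have -> : lift ord0 ord0 = 1 :> 'I_3 by apply/val_inj.
  have -> : lift ord0 (lift ord0 ord0) = 2%:R :> 'I_3 by apply/val_inj.
  ring.
pose q := \sum_(m <- msupp f) f@_m *: \prod_i c i ^+ m i.
have qE a : f.@[secant E a b 0] = q.[a].
  rewrite mevalE horner_sum; apply: eq_bigr => m _.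
  rewrite hornerZ horner_prod; congr (_ * _); apply: eq_bigr => i _.
  by rewrite horner_exp cE.
exists (('X - b%:P) * q) => [|a]; last by rewrite qE !hornerE.
have [-> | q0] := eqVneq q 0; first by rewrite mulr0 size_poly0.
rewrite size_monicM ?monicXsubC // size_XsubC addSn /= ltnS.
apply: leq_trans (size_sum _ _ _) _; rewrite big_seq.
elim/big_rec: _ => // m k /fd <- kd; rewrite geq_max kd andbT {k kd}.
apply: leq_trans (size_scale_leq _ _) _; rewrite /= mdegE.
elim/big_rec2: _ => [|i k p _ kp]; first by rewrite size_poly1.
have szci : (size (c i ^+ m i) <= (m i).+1)%N.
  apply: leq_trans (size_poly_exp_leq _ _) _; rewrite ltnS.
  by case: (size (c i)) (szc i) => [|[|[|]]] //= _; lia.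
apply: leq_trans (size_polyMleq _ _) _.
by have := leq_add szci kp; rewrite addSn addnS; case: (_ + size p)%N.
Qed.

(* [complete_sym m] is the complete symmetric polynomial of degree [m] in
   [x, y], written in [X0 = 1, X1 = x + y, X2 = x * y] and homogenized by [X0]. *)
Fixpoint complete_sym (m : nat) : {mpoly F[3]} :=
  match m with
  | 0 => 1
  | 1 => 'X_(1 : 'I_3)
  | (m'.+1 as m1).+1 => 'X_(1 : 'I_3) * complete_sym m1
      - 'X_(0 : 'I_3) * 'X_(2%:R : 'I_3) * complete_sym m'
  end.

Lemma complete_sym_homog m : complete_sym m \is m.-homog.
Proof.
suff [] : complete_sym m \is m.-homog /\ complete_sym m.+1 \is m.+1.-homog by [].
have X1 (i : 'I_3) : ('X_i : {mpoly F[3]}) \is 1.-homog by rewrite dhomogX /= mdeg1.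
elim: m => [|m [Hm Hm1]]; first by split; [exact: dhomog1 | exact: X1].
split=> //; rewrite [complete_sym _]/= rpredB //; first exact: (dhomogM (X1 _) Hm1).
exact: (dhomogM (dhomogM (X1 _) (X1 _)) Hm).
Qed.

(** The differences of powers obey the recurrence of [complete_sym]; two consecutive degrees are
    carried through the induction. *)
Lemma complete_symE m x y :
  (x - y) * (complete_sym m).@[(\row_i [:: 1; x + y; x * y]`_i) 0] = x ^+ m.+1 - y ^+ m.+1.
Proof.
set v := \row_i _.
suff [] : (x - y) * (complete_sym m).@[v 0] = x ^+ m.+1 - y ^+ m.+1
  /\ (x - y) * (complete_sym m.+1).@[v 0] = x ^+ m.+2 - y ^+ m.+2 by [].
elim: m => [|m [Hm Hm1]].
  by rewrite /= meval1 mevalXU mxE /=; split; ring.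
split=> //; rewrite [complete_sym _]/= mevalB !mevalM !mevalXU.
have -> : v 0 0 = 1 by rewrite mxE.
have -> : v 0 1 = x + y by rewrite mxE.
have -> : v 0 (2%:R) = x * y by rewrite mxE.
rewrite mulrBr mulrCA Hm1 mul1r mulrCA Hm !exprS; ring.
Qed.

(** The right-hand side is a combination of terms [a ^+ k * b ^+ l - b ^+ k * a ^+ l]. Each is, up
    to sign, [a - b] times a power of [a * b] times a complete symmetric polynomial, hence comes
    from a form. *)
Lemma secant_form_alternating E d (P Q : {poly F}) : E \in unitmx ->
  (size P <= d.+2)%N -> (size Q <= d.+2)%N ->
  exists2 f, f \is d.-homog
    & forall a b, (a - b) * f.@[secant E a b 0] = P.[a] * Q.[b] - P.[b] * Q.[a].
Proof.
move=> Eu szP szQ.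
have X1 (i : 'I_3) : ('X_i : {mpoly F[3]}) \is 1.-homog by rewrite dhomogX /= mdeg1.
(* The power of ['X_0], which has value 1, brings the degree up to [d]:
   [(d.+1 - l) + k + (l - k.+1) = d] for [k < l]. *)
pose g (k l : 'I_d.+2) : {mpoly F[3]} :=
  'X_(0 : 'I_3) ^+ (d.+1 - l) * 'X_(2%:R : 'I_3) ^+ k * complete_sym (l - k.+1).
pose h (k l : 'I_d.+2) := if (k < l)%N then - g k l else if (l < k)%N then g l k else 0.
have gd (k l : 'I_d.+2) : (k < l)%N -> g k l \is d.-homog.
  move=> kl; have -> : d = (1 * (d.+1 - l) + 1 * k + (l - k.+1))%N.
    by have := ltn_ord l; lia.
  by rewrite dhomogM ?complete_sym_homog // dhomogM // dhomogMn.
have gE (k l : 'I_d.+2) x y : (k < l)%N ->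
    (x - y) * (g k l).@[(\row_i [:: 1; x + y; x * y]`_i) 0]
      = x ^+ l * y ^+ k - x ^+ k * y ^+ l.
  move=> kl; rewrite !mevalM !rmorphXn /= !mevalXU !mxE /= expr1n mul1r.
  rewrite mulrCA complete_symE exprMn -subSn // subSS.
  have := subnKC (ltnW kl); set n := (l - k)%N => <-.
  by rewrite !exprD; ring.
pose f := \sum_(k < d.+2) \sum_(l < d.+2) (P`_k * Q`_l) *: h k l.
exists (mx_comp (invmx E) f).
  apply/mx_comp_dhomog; rewrite rpred_sum // => k _; rewrite rpred_sum // => l _.
  rewrite rpredZ // /h; case: ltngtP => [/gd|/gd|_] //; last exact: rpred0.
  by move=> gkl; rewrite rpredN.
move=> a b; rewrite meval_mx_comp /secant mulmxK // /f.
rewrite (horner_coef_wide a szP) (horner_coef_wide b szP).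
rewrite (horner_coef_wide a szQ) (horner_coef_wide b szQ).
rewrite !big_distrlr /= -sumrB raddf_sum mulr_sumr; apply: eq_bigr => k _ /=.
rewrite -sumrB raddf_sum mulr_sumr; apply: eq_bigr => l _ /=.
rewrite mevalZ mulrCA.
have -> : (a - b) * (h k l).@[(\row_i [:: 1; a + b; a * b]`_i) 0]
    = a ^+ k * b ^+ l - b ^+ k * a ^+ l.
  rewrite /h; case: ltngtP => [kl|lk|->]; last by rewrite meval0 mulr0 mulrC subrr.
    by rewrite mevalN mulrN gE //; ring.
  by rewrite gE //; ring.
ring.
Qed.

End Secants.

(** * The codimension of the forms vanishing on stars of tangents *)

Section SecantDim.
Local Open Scope ring_scope.

Variables (F : fieldType) (K : finType) (C : eqType).
Variables (z : K -> F) (cl : K -> C) (pos : K -> nat) (w : C) (sz : C -> nat).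
Variable d : nat.
Hypothesis z_inj : injective z.
Hypothesis pos_inj : forall x y, cl x = cl y -> pos x = pos y -> x = y.
Hypothesis card_pos : forall c m,
  #|[set x | (cl x == c) && (pos x < m)%N]| = minn m (sz c).
Hypothesis card_small : (#|[set x | cl x != w]| <= (sz w).+1)%N.
Variable E : 'M[F]_3.
Hypothesis E_unit : E \in unitmx.

Lemma dim_secant_forms (U : {vspace dhomog 3 F d}) :
  (forall f : dhomog 3 F d, f \in U <->
     (forall x y, x != y -> cl x = cl y ->
        (mpoly_of_dhomog f).@[secant E (z x) (z y) 0] = 0)) ->
  (\dim {: dhomog 3 F d} - \dim U)%N = #|basic_pairs cl pos w sz d|.
Proof.
move=> memU.
(* The factor [z p.1 - z p.2] makes the value alternating and, as [z] is injective, does not change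
   its zeros at pairs of distinct tangents. *)
pose ev (p : K * K) (f : dhomog 3 F d) : F :=
  (z p.1 - z p.2) * (mpoly_of_dhomog f).@[secant E (z p.1) (z p.2) 0].
have ev_lin p : linear_for *%R (ev p).
  by move=> a f g; rewrite /ev (linearP (@mpoly_of_dhomog 3 F d)) mevalD mevalZ; ring.
pose evL p : {scalar dhomog 3 F d} :=
  HB.pack (ev p) (GRing.isLinear.Build F (dhomog 3 F d) F *%R (ev p) (ev_lin p)).
have /fin_all_exists [g gP] (x : K * K) : exists f : dhomog 3 F d,
    x \in basic_pairs cl pos w sz d -> ev x f != 0 /\
    forall y, y \in basic_pairs cl pos w sz d -> y != x -> ev y f != 0 ->
      (pair_rank cl pos w sz d y < pair_rank cl pos w sz d x)%N.
  have [xA|_] := boolP (x \in _); last by exists 0.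
  have [P [Q [szP szQ nz sep]]] := basic_pairs_separated z_inj card_pos card_small xA.
  have [f fd fE] := secant_form_alternating E_unit szP szQ.
  by exists (DHomog fd) => _; split; [rewrite /ev /= fE | move=> y; rewrite /ev /= fE; apply: sep].
apply: (@dim_zeros_triangular _ _ _ evL _ _ (pair_rank cl pos w sz d) g).
- move=> f; apply/idP/forall_inP => [/memU fU p|f0].
    rewrite inE => /and3P[/eqP cp lp _]; rewrite /= /ev fU ?mulr0 //.
    by apply: contraTneq lp => ->; rewrite ltnn.
  apply/memU => x y xy cxy.
  suff : (z x - z y) * (mpoly_of_dhomog f).@[secant E (z x) (z y) 0] = 0.
    by move/eqP; rewrite mulf_eq0 subr_eq0 (inj_eq z_inj) (negPf xy) => /eqP.
  refine (basic_pairs_span z_inj pos_inj card_pos card_small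
    (G := fun a b => (a - b) * (mpoly_of_dhomog f).@[secant E a b 0]) _ _ _ _ cxy).
  - move=> b; apply: secant_form_poly; exact: dhomog_is_dhomog.
  - by move=> a b; rewrite secantC; ring.
  - by move=> a; rewrite subrr mul0r.
  by move=> p /f0 /eqP.
- by move=> x /gP[].
by move=> x y /gP[_]; apply.
Qed.

End SecantDim.

(** * Indexing the tangents of three stars *)

Section ThreeStars.
Local Open Scope ring_scope.

Variables t r s : nat.

Definition tangents : finType := ('I_t + ('I_r + 'I_s))%type.

Definition tangent_star (x : tangents) : nat :=
  match x with inl _ => 0 | inr (inl _) => 1 | inr (inr _) => 2 end.

Definition tangent_pos (x : tangents) : nat :=
  match x with inl i => i | inr (inl i) => i | inr (inr i) => i end.

(** Labels from 3 on, which no tangent carries, get the default size 0. *)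
Definition star_size (c : nat) : nat := nth 0%N [:: t; r; s] c.

Lemma tangent_pos_inj x y : tangent_star x = tangent_star y ->
  tangent_pos x = tangent_pos y -> x = y.
Proof. by case: x y => [i|[i|i]] [j|[j|j]] //= _ /val_inj->. Qed.

Lemma card_tangent_pos c m :
  #|[set x | (tangent_star x == c) && (tangent_pos x < m)%N]| = minn m (star_size c).
Proof.
rewrite -sum1dep_card big_mkcond !big_sumType /=.
have cnt n b : (\sum_(i < n) (if b && (i < m) then 1 else 0) = b * minn m n)%N.
  case: b => /=; last by rewrite big1.
  by rewrite mul1n minnC -sum_ord_lt; apply: eq_bigr => i _; case: (i < m)%N.
by rewrite !cnt; case: c => [|[|[|c]]]; rewrite /star_size /= ?nth_nil; lia.
Qed.

Lemma card_small_tangents :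
  #|[set x | tangent_star x != 0%N]| = (r + s)%N.
Proof.
rewrite -sum1dep_card big_mkcond !big_sumType /=.
by rewrite big1 // !sum1_card !card_ord.
Qed.

Lemma card_tangent_pairs d :
  #|basic_pairs tangent_star tangent_pos 0%N star_size d| = hilbert_value t r s d.
Proof.
rewrite -sum1dep_card big_mkcond /=.
rewrite -(pair_bigA _ (fun x y => if [&& tangent_star x == tangent_star y,
  (tangent_pos x < tangent_pos y)%N & if tangent_star x == 0%N then
  (tangent_pos y < d.+2)%N else (tangent_pos x < d.+2 - star_size 0)%N] then 1%N else 0%N)) /=.
rewrite !big_sumType /=.
have split (i : tangents -> nat) : \sum_x i x = (\sum_(a < t) i (inl a)
    + (\sum_(a < r) i (inr (inl a)) + \sum_(a < s) i (inr (inr a))))%N.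
  by rewrite !big_sumType.
rewrite /hilbert_value -card_ord_pairs big_split /= -!card_low_pairs; congr (_ + (_ + _))%N;
  apply: eq_bigr => a _; rewrite split /= ?big1_eq ?addn0 ?add0n;
  apply: eq_bigr => b _; by case: (_ && _).
Qed.

End ThreeStars.

(** * Irreducible conics *)

Section Euler.
Local Open Scope ring_scope.

Variables (F : fieldType) (n : nat).
Implicit Types (f : {mpoly F[n]}).

Lemma mderiv_dhomog f d i : f \is d.+1.-homog -> f^`M(i) \is d.-homog.
Proof.
move=> /dhomogP fd; apply/dhomogP => m; rewrite mcoeff_msupp mcoeff_deriv.
apply: contraNeq => md; apply/eqP; rewrite memN_msupp_eq0 ?mul0rn //.
by apply: contra md => /fd /=; rewrite mdegD mdeg1 addn1 => -[->].
Qed.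

Lemma euler_dhomog f d : f \is d.-homog ->
  d%:R *: f = \sum_(i < n) 'X_i * f^`M(i).
Proof.
move=> /dhomogP fd; rewrite [in RHS](mpolyE f).
under eq_bigr => i _ do rewrite raddf_sum mulr_sumr.
rewrite exchange_big /= [in LHS](mpolyE f) scaler_sumr.
rewrite !big_seq; apply: eq_bigr => m /fd /= md.
rewrite -md mdegE natr_sum scaler_suml; apply: eq_bigr => i _.
rewrite mderivZ mderivX -!scalerAr scalerA mulrC -scalerA.
have [->|mi] := posnP (m i); first by rewrite !scale0r ?scaler0.
congr (_ *: (_ *: _)); rewrite -mpolyXD; congr 'X_[_].
by rewrite addmC submK // lep1mP -lt0n.
Qed.

Lemma dhomog0_const f : f \is 0.-homog -> f = (f@_0)%:MP.
Proof.
move=> /dhomogP f0; apply/mpolyP => m; rewrite mcoeffC.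
have [->|m0] := eqVneq m 0%MM; first by rewrite mulr1.
rewrite mulr0; apply: memN_msupp_eq0.
by apply: contra m0 => /f0 /eqP; rewrite mdeg_eq0.
Qed.

End Euler.

Section Gram.
Local Open Scope ring_scope.

Variable F : fieldType.
Implicit Types (q : {mpoly F[3]}) (u v w : 'rV[F]_3).

(** The Hessian, that is, twice the symmetric matrix of a quadratic form; its entries are then
    constants, read off at the exponent 0. *)
Definition gram q : 'M[F]_3 := \matrix_(i, j) (q^`M(i)^`M(j))@_0.

Lemma gram_sym q : (gram q)^T = gram q.
Proof. by apply/matrixP => i j; rewrite !mxE mderiv_comm. Qed.

Definition linear_form (u : 'rV[F]_3) : {mpoly F[3]} := \sum_j u 0 j *: 'X_j.

Lemma mderiv_gram q i : q \is 2.-homog -> q^`M(i) = linear_form (row i (gram q)).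
Proof.
move=> q2; have := euler_dhomog (mderiv_dhomog i q2); rewrite scale1r => ->.
apply: eq_bigr => j _.
rewrite [X in _ * X]dhomog0_const; last by rewrite !mderiv_dhomog.
by rewrite !mxE mulrC mul_mpolyC.
Qed.

Lemma meval_linear_form u v : (linear_form u).@[v 0] = (u *m v^T) 0 0.
Proof.
rewrite /linear_form raddf_sum mxE; apply: eq_bigr => j _ /=.
by rewrite mevalZ mevalXU mxE.
Qed.

Lemma gram_quadratic q : q \is 2.-homog ->
  2%:R *: q = \sum_i 'X_i * linear_form (row i (gram q)).
Proof.
by move=> q2; rewrite (euler_dhomog q2); apply: eq_bigr => i _; rewrite mderiv_gram.
Qed.

Lemma gradient_gram q v w : q \is 2.-homog ->
  \sum_i (q^`M(i)).@[v 0] * w 0 i = (v *m gram q *m w^T) 0 0.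
Proof.
move=> q2; have -> : v *m gram q *m w^T = (w *m (gram q *m v^T))^T.
  by rewrite !trmx_mul trmxK gram_sym.
rewrite !mxE; apply: eq_bigr => i _.
by rewrite mderiv_gram // meval_linear_form -row_mul !mxE mulrC.
Qed.

Lemma meval_gram q v : q \is 2.-homog ->
  2%:R * q.@[v 0] = (v *m gram q *m v^T) 0 0.
Proof.
move=> q2; rewrite -mevalZ (euler_dhomog q2) raddf_sum -gradient_gram //.
by apply: eq_bigr => i _; rewrite /= mevalM mevalXU mulrC.
Qed.

(** A unit is a constant, and a linear form has no constant term. In this form the conclusion
    contradicts [q != 0] when [q] is a product of linear forms. *)
Lemma linear_form_nonunit u : linear_form u \is a GRing.unit -> linear_form u = 0.
Proof.
case/andP=> /eqP uE _; rewrite uE.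
have : linear_form u \is 1.-homog.
  by rewrite rpred_sum // => j _; rewrite rpredZ // dhomogX /= mdeg1.
move/dhomog_nemf_coeff => -> //; by rewrite /= mdeg0.
Qed.

(** Such a matrix would make [q] the product of the linear forms of [u] and [v], by Euler's identity
    and division by 2. *)
Lemma irreducible_gram_not_split q u v : (2%:R : F) != 0 -> irreducible_conic q ->
  gram q <> u^T *m v + v^T *m u.
Proof.
move=> two [q2 [q0 _ irr]] qE.
have qf : q = linear_form u * linear_form v.
  apply: (scalerI two); rewrite gram_quadratic // qE.
  have rowE i : linear_form (row i (u^T *m v + v^T *m u))
      = u 0 i *: linear_form v + v 0 i *: linear_form u.
    rewrite !scaler_sumr -big_split; apply: eq_bigr => j _.
    by rewrite !mxE !big_ord1 !mxE scalerDl !scalerA.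
  under eq_bigr => i _ do rewrite rowE mulrDr -!scalerAr !scalerAl.
  rewrite big_split -!mulr_suml /= -/(linear_form u) -/(linear_form v).
  by rewrite [linear_form v * _]mulrC -mulr2n scaler_nat.
case: (irr _ _ qf) => /linear_form_nonunit uv0; move: q0; rewrite qf uv0 ?mul0r ?mulr0 eqxx //.
Qed.

End Gram.

Section Rows3.
Local Open Scope ring_scope.

Variable F : fieldType.
Implicit Types (u v w x y : 'rV[F]_3).

Lemma sum_ord3 (V : nmodType) (f : 'I_3 -> V) :
  \sum_i f i = f 0 + f 1 + f (2%:R).
Proof.
rewrite !big_ord_recl big_ord0 addr0 addrA.
by congr (f _ + f _ + f _); apply/val_inj.
Qed.

Definition rows3 u v w : 'M[F]_3 := \matrix_i [:: u; v; w]`_i.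

Lemma mul_rows3 u v w x :
  x *m rows3 u v w = x 0 0 *: u + x 0 1 *: v + x 0 (2%:R) *: w.
Proof. by rewrite mulmx_sum_row sum_ord3 !rowK. Qed.

Lemma rows3_unit u v w :
  (forall a b c, a *: u + b *: v + c *: w = 0 -> [/\ a = 0, b = 0 & c = 0]) ->
  rows3 u v w \in unitmx.
Proof.
move=> ind; rewrite -row_free_unit; apply/inj_row_free => x.
rewrite mul_rows3 => /ind[x0 x1 x2]; apply/rowP => i; rewrite mxE.
by case: i => [[|[|[|]]]] //= p; [rewrite -[RHS]x0|rewrite -[RHS]x1|rewrite -[RHS]x2];
   congr (x 0 _); apply/val_inj.
Qed.

Lemma complete_independent u v :
  (forall a b, a *: u + b *: v = 0 -> a = 0 /\ b = 0) ->
  exists w, rows3 u w v \in unitmx.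
Proof.
move=> ind; pose U := (<[u]> + <[v]>)%VS.
have dimU : (\dim U < \dim {: 'rV[F]_3})%N.
  apply: leq_ltn_trans (dimv_add_leqif _ _) _; rewrite !dim_vline dimvf /dim /= mul1n.
  by case: (u != 0); case: (v != 0).
pose w := vpick (U^C)%VS; exists w.
have w0 : w != 0.
  rewrite vpick0 -dimv_eq0 dimv_compl -lt0n subn_gt0 //.
have wU : w \notin U.
  apply: contra w0 => wU; rewrite -memv0 -(capv_compl U) memv_cap wU.
  exact: memv_pick.
apply: rows3_unit => a b c abc.
have b0 : b = 0.
  apply: contraNeq wU => b0; have -> : w = - b^-1 *: (a *: u + c *: v).
    apply: (scalerI b0); rewrite scalerA mulrN divff // scaleN1r; apply/eqP.
    by rewrite -addr_eq0 addrCA addrA abc.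
  by rewrite memvZ // memv_add // memvZ // memv_line.
by move: abc; rewrite b0 scale0r addr0 => /ind[].
Qed.

Lemma dot_row3 x a b c :
  (x *m (\row_i [:: a; b; c]`_i)^T) 0 0 = x 0 0 * a + x 0 1 * b + x 0 (2%:R) * c.
Proof. by rewrite mxE sum_ord3 !mxE. Qed.

Lemma point_line (p : plane_point F) : exists2 v, v != 0 & point_space p = <[v]>%VS.
Proof.
case: p => U /= /eqP dU; exists (vpick U); first by rewrite vpick0 -dimv_eq0 dU.
apply/eqP; rewrite eq_sym eqEdim -memvE memv_pick dU dim_vline.
by rewrite vpick0 -dimv_eq0 dU.
Qed.

(** A nonzero vector [n] orthogonal to the three rows would be the equation of a line through the
    three points. *)
Lemma noncollinear_unit (p1 p2 p3 : plane_point F) u v w :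
  point_space p1 = <[u]>%VS -> point_space p2 = <[v]>%VS -> point_space p3 = <[w]>%VS ->
  ~ collinear p1 p2 p3 -> rows3 u v w \in unitmx.
Proof.
move=> pu pv pw ncol; rewrite -unitmx_tr -row_free_unit; apply/inj_row_free => n nM.
apply/eqP; apply: contra_notT ncol => n0.
pose h := linfun (mulmxr n^T : 'rV[F]_3 -> 'rV[F]_1).
have dimL : \dim (lker h) == 2%N.
  have := limg_ker_dim h fullv; rewrite capfv dimvf /dim /= => dims.
  suff : \dim (h @: fullv) = 1%N by move: dims; case: (\dim _) => [|[|[|]]] //=; lia.
  apply/eqP; rewrite eqn_leq (leq_trans (dimvS (subvf _))) ?dimvf //=.
  rewrite lt0n dimv_eq0; apply: contra n0 => /eqP h0; apply/eqP/rowP => i.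
  have : h (delta_mx 0 i) = 0 by apply/eqP; rewrite -memv0 -h0 memv_img ?memvf.
  by rewrite lfunE /= -rowE => /rowP/(_ 0); rewrite !mxE.
have on_h (y : 'rV[F]_3) : y *m n^T = 0 -> y \in lker h.
  by move=> yn; rewrite memv_ker lfunE /= yn.
have rowM i : row i (rows3 u v w) *m n^T = 0.
  by rewrite -row_mul -[_ *m _]trmxK trmx_mul trmxK nM trmx0 row0.
exists (Line dimL); rewrite /on_line pu pv pw -!memvE /=.
by apply/and3P; split; apply: on_h; [have := rowM 0 | have := rowM 1 | have := rowM (2%:R)];
  rewrite rowK.
Qed.

End Rows3.

(** * Normal form of an irreducible conic through two given points *)

Section NormalForm.
Local Open Scope ring_scope.

Variable F : numClosedFieldType.
Variable q : {mpoly F[3]}.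
Hypothesis q_irr : irreducible_conic q.
Implicit Types (u v w x y : 'rV[F]_3).

Local Notation B x y := ((x *m gram q *m y^T) 0 0).

Lemma polar_sym x y : B x y = B y x.
Proof.
have -> : x *m gram q *m y^T = (y *m gram q *m x^T)^T.
  by rewrite !trmx_mul trmxK gram_sym mulmxA.
by rewrite mxE.
Qed.

Lemma polarDl x y w : B (x + y) w = B x w + B y w.
Proof. by rewrite !mulmxDl mxE. Qed.

Lemma polarZl a x w : B (a *: x) w = a * B x w.
Proof. by rewrite -!scalemxAl mxE. Qed.

Lemma polarDr x y w : B w (x + y) = B w x + B w y.
Proof. by rewrite (polar_sym w (x + y)) polarDl (polar_sym x) (polar_sym y). Qed.

Lemma polarZr a x w : B w (a *: x) = a * B w x.
Proof. by rewrite (polar_sym w (a *: x)) polarZl (polar_sym x). Qed.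

Lemma polar_not_split (M : 'M_3) u v : M \in unitmx ->
  ~ (forall x y, B (x *m M) (y *m M) = (x *m u^T) 0 0 * (y *m v^T) 0 0
                                     + (x *m v^T) 0 0 * (y *m u^T) 0 0).
Proof.
move=> Mu BE; have two : (2%:R : F) != 0 by rewrite pnatr_eq0.
apply: (irreducible_gram_not_split (u := u *m (invmx M)^T) (v := v *m (invmx M)^T) two q_irr).
apply/matrixP => i j.
have -> : gram q i j = B (delta_mx 0 i : 'rV_3) (delta_mx 0 j : 'rV_3).
  by rewrite trmx_delta -rowE -colE !mxE.
have := BE ((delta_mx 0 i : 'rV_3) *m invmx M) ((delta_mx 0 j : 'rV_3) *m invmx M).
rewrite !mulmxKV // => ->.
have dl (k : 'I_3) (s : 'rV_3) :
    ((delta_mx 0 k : 'rV_3) *m invmx M *m s^T) 0 0 = (s *m (invmx M)^T) 0 k.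
  rewrite -[in LHS]rowE -[in RHS](trmxK s) -trmx_mul [RHS]mxE.
  by rewrite -row_mul mxE.
have outer (a b : 'rV[F]_3) : (a^T *m b) i j = a 0 i * b 0 j.
  by rewrite mxE big_ord1 mxE.
by rewrite !dl [RHS]mxE !outer.
Qed.

(** The conic becomes [x1^2 = 4 x0 x2], with points [(1, 2a, a^2)], that is, [secant E a a]; [u]
    gets the parameter 0 and [v] the parameter infinity. *)
Lemma conic_normal_form u v :
  q.@[u 0] = 0 -> q.@[v 0] = 0 ->
  (forall a b, a *: u + b *: v = 0 -> a = 0 /\ b = 0) ->
  exists E : 'M[F]_3, exists2 k : F, k != 0 &
    [/\ E \in unitmx, row 0 E = u, row (2%:R) E = v & forall x y,
      B (x *m E) (y *m E)
        = k * (2%:R * (x 0 1 * y 0 1)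
               - 4%:R * (x 0 0 * y 0 (2%:R) + x 0 (2%:R) * y 0 0))].
Proof.
move=> qu qv ind; have [q2 _] := q_irr.
have two : (2%:R : F) != 0 by rewrite pnatr_eq0.
have four : (4%:R : F) != 0 by rewrite pnatr_eq0.
have Buu : B u u = 0 by rewrite -meval_gram // qu mulr0.
have Bvv : B v v = 0 by rewrite -meval_gram // qv mulr0.
have [w0 Mu] := complete_independent ind.
have Bexp s x y : B (x *m rows3 u s v) (y *m rows3 u s v) =
    x 0 1 * (B s u * y 0 0 + B s s * y 0 1 + B s v * y 0 (2%:R))
    + (x 0 0 * B s u + x 0 (2%:R) * B s v) * y 0 1
    + B u v * (x 0 0 * y 0 (2%:R) + x 0 (2%:R) * y 0 0).
  rewrite !mul_rows3 !(polarDl, polarDr, polarZl, polarZr) Buu Bvv.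
  by rewrite (polar_sym u s) (polar_sym v s) (polar_sym v u); ring.
(* Otherwise [Bexp] is the polar form of the middle coordinate times a linear form; halving
   [B w0 w0] shares the square term between the two symmetric summands. *)
have Buv : B u v != 0.
  apply/eqP => Buv0.
  apply: (@polar_not_split _ (\row_i [:: 0; 1; 0]`_i)
    (\row_i [:: B w0 u; B w0 w0 / 2%:R; B w0 v]`_i) Mu) => x y.
  by rewrite Bexp Buv0 !dot_row3; field.
(* The correction of [w0] by [u] and [v] that is polar to both. *)
pose w := w0 - (B w0 v / B u v) *: u - (B w0 u / B u v) *: v.
have Bwu : B w u = 0.
  by rewrite /w -!scaleNr !(polarDl, polarZl) Buu (polar_sym v u); field.
have Bwv : B w v = 0.
  by rewrite /w -!scaleNr !(polarDl, polarZl) Bvv; field.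
have ind3 c s1 s2 : c != 0 -> rows3 u (c *: (w0 - s1 *: u - s2 *: v)) v \in unitmx.
  move=> c0; pose T := rows3 (\row_i [:: 1; 0; 0]`_i)
    (\row_i [:: - (c * s1); c; - (c * s2)]`_i) (\row_i [:: 0; 0; 1 : F]`_i).
  have -> : rows3 u (c *: (w0 - s1 *: u - s2 *: v)) v = T *m rows3 u w0 v.
    apply/row_matrixP => i; rewrite row_mul mul_rows3 !rowK.
    case: i => [[|[|[|]]]] //= p; rewrite !mxE /=.
    - by rewrite scale1r !scale0r !addr0.
    - by rewrite !scalerBr !scalerA !scaleNr; congr (_ - _); exact: addrC.
    by rewrite scale1r !scale0r !add0r.
  rewrite unitmx_mul Mu andbT; apply: rows3_unit => a b d.
  move=> /rowP abd; have := abd 0; have := abd 1; have := abd (2%:R).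
  rewrite !mxE /= !mulr0 !mulr1 !addr0 !add0r => e2 e1 e0.
  have {e1} b0 : b = 0 by move/eqP: e1; rewrite mulf_eq0 (negPf c0) orbF => /eqP.
  by move: e0 e2; rewrite b0 !mul0r addr0 add0r.
have Ew c : c != 0 -> rows3 u (c *: w) v \in unitmx by exact: ind3.
have Bww : B w w != 0.
  apply/eqP => Bww0.
  apply: (@polar_not_split _ (\row_i [:: B u v; 0; 0]`_i)
    (\row_i [:: 0; 0; 1]`_i) (Ew _ (oner_neq0 _))) => x y.
  by rewrite Bexp scale1r Bwu Bwv Bww0 !dot_row3; ring.
(* Matching coefficients with the normal form: [B u v = - 4 k], and [c ^+ 2 * B w w = 2 k] for the
   rescaled middle vector. *)
pose k := - B u v / 4%:R; pose c := sqrtC (2%:R * k / B w w).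
have k0 : k != 0 by apply: mulf_neq0; rewrite ?invr_eq0 ?oppr_eq0.
have c2 : c ^+ 2 = 2%:R * k / B w w by rewrite sqrtCK.
have c0 : c != 0.
  by rewrite -sqrf_eq0 c2; apply: mulf_neq0; rewrite ?invr_eq0 //; apply: mulf_neq0.
exists (rows3 u (c *: w) v), k => //; split; rewrite ?rowK ?Ew // => x y.
rewrite Bexp !(polarZl, polarZr) Bwu Bwv.
have -> : c * (c * B w w) = 2%:R * k by rewrite mulrA -expr2 c2 divfK.
have -> : B u v = - (4%:R * k) by rewrite /k; field.
ring.
Qed.

End NormalForm.

(** * Parameters of a finite family of tangents *)

Section Parametrization.
Local Open Scope ring_scope.

Variable F : numClosedFieldType.
Variable q : {mpoly F[3]}.
Hypothesis q_irr : irreducible_conic q.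
Variables (I : finType) (P : I -> plane_point F) (L : I -> plane_line F).
Hypothesis tanPL : forall i, tangent_at q (P i) (L i).

Lemma avoid_seq (s : seq F) : exists c, c \notin s.
Proof.
pose S := \sum_(x <- s) `|x|; exists (1 + S); apply/negP => cs.
have S0 : 0 <= S by apply: sumr_ge0 => x _.
have : `|1 + S| <= S.
  by rewrite {2}/S (big_rem _ cs) /= lerDl; apply: sumr_ge0.
by rewrite ger0_norm ?addr_ge0 // gerDr lt_geF ?ltr01.
Qed.

Definition conic_point (E : 'M[F]_3) (c : F) : 'rV[F]_3 := secant E c c.

(** At [(1, 2a, a^2)] the gradient is proportional to [(a^2, -a, 1)], and [a] is recovered as
    [x1 / (2 x0)]. The last row of [E] is the point with parameter infinity. *)
Lemma tangent_parameter (E : 'M[F]_3) (k : F) i : k != 0 -> E \in unitmx ->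
  (forall x y : 'rV_3, ((x *m E) *m gram q *m (y *m E)^T) 0 0
        = k * (2%:R * (x 0 1 * y 0 1)
               - 4%:R * (x 0 0 * y 0 (2%:R) + x 0 (2%:R) * y 0 0))) ->
  row (2%:R) E \notin point_space (P i) ->
  exists a, [/\ forall c, conic_point E c \in point_space (P i) -> c = a
    & forall y : 'rV_3, (y *m E \in line_space (L i)) =
        (a ^+ 2 * y 0 0 - a * y 0 1 + y 0 (2%:R) == 0)].
Proof.
move=> k0 Eu BE E2P; have [q2 _] := q_irr.
have [two four] : (2%:R : F) != 0 /\ (4%:R : F) != 0 by rewrite !pnatr_eq0.
have [v v0 Pv] := point_line (P i); have [qP tan] := tanPL i.
have [x vE] : exists x, v = x *m E by exists (v *m invmx E); rewrite mulmxKV.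
have vP : v \in point_space (P i) by rewrite Pv memv_line.
have := meval_gram v q2; rewrite qP // mulr0 vE BE => /esym/eqP.
rewrite mulf_eq0 (negPf k0) /= => /eqP conic.
(* On [x1^2 = 4 x0 x2], a zero [x0] forces [x1 = 0], leaving only the point at infinity. *)
have x0 : x 0 0 != 0.
  apply: contraNneq E2P => x00; move: conic.
  rewrite x00 mul0r mulr0 addr0 mulr0 subr0 => /eqP.
  rewrite mulf_eq0 (negPf two) mulf_eq0 orbb /= => /eqP x1.
  have vE2 : v = x 0 (2%:R) *: row (2%:R) E.
    by rewrite vE mulmx_sum_row sum_ord3 x00 x1 !scale0r !add0r.
  have x2 : x 0 (2%:R) != 0 by apply: contraNneq v0 => x2; rewrite vE2 x2 scale0r.
  by rewrite Pv vE2; apply/vlineP; exists (x 0 (2%:R))^-1; rewrite scalerA mulVf ?scale1r.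
exists (x 0 1 / (2%:R * x 0 0)); split=> [c|y].
  rewrite Pv => /vlineP[l lE].
  have lx : (\row_i [:: 1; c + c; c * c]`_i) = l *: x.
    by apply: (can_inj (mulmxK Eu)); rewrite -scalemxAl -vE -lE.
  move/rowP: lx => lx; have := lx 0; have := lx 1; rewrite !mxE /= => l1 l0.
  have lE' : l = (x 0 0)^-1 by apply: (mulIf x0); rewrite mulVf // -l0.
  have -> : c = (c + c) / 2%:R by field.
  by rewrite l1 lE'; field; rewrite x0.
have x2E : (x 0 1) ^+ 2 = 4%:R * x 0 0 * x 0 (2%:R).
  by apply: (mulfI two); apply/subr0_eq; rewrite -conic; ring.
have {}x2E : x 0 (2%:R) = (x 0 1) ^+ 2 / (4%:R * x 0 0).
  by rewrite x2E mulrAC divff ?mul1r // mulf_neq0.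
rewrite (tan v) // gradient_gram // vE BE x2E.
set lhs := k * _; set rhs := _ - _ + _.
have -> : lhs = - (4%:R * k * x 0 0) * rhs by rewrite /lhs /rhs; field; rewrite x0.
by rewrite mulf_eq0 oppr_eq0 !mulf_eq0 (negPf four) (negPf k0) (negPf x0).
Qed.

Lemma contact_parametrization i0 i1 : P i0 <> P i1 ->
  exists2 E : 'M[F]_3, E \in unitmx &
    exists a : I -> F, forall i (y : 'rV_3), (y *m E \in line_space (L i)) =
        (a i ^+ 2 * y 0 0 - a i * y 0 1 + y 0 (2%:R) == 0).
Proof.
move=> P01; have [q2 _] := q_irr.
have [u u0 Pu] := point_line (P i0); have [v v0 Pv] := point_line (P i1).
have uv : u \notin <[v]>%VS.
  apply/negP => uv; apply: P01; apply/val_inj; rewrite /= Pu Pv.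
  by apply/eqP; rewrite eqEdim -memvE uv !dim_vline u0 v0.
have [qu qv] : q.@[u 0] = 0 /\ q.@[v 0] = 0.
  split; first by have [-> //] := tanPL i0; rewrite Pu memv_line.
  by have [-> //] := tanPL i1; rewrite Pv memv_line.
have ind (s t : 'rV[F]_3) : t != 0 -> s \notin <[t]>%VS ->
    forall a b, a *: s + b *: t = 0 -> a = 0 /\ b = 0.
  move=> t0 st a b ab; have a0 : a = 0.
    apply: contraNeq st => a0; apply/vlineP; exists (- (a^-1 * b)).
    apply: (scalerI a0); rewrite scalerA mulrN mulrA divff // mul1r scaleNr.
    by apply/eqP; rewrite -addr_eq0 ab.
  move/eqP: ab; rewrite a0 scale0r add0r scaler_eq0 (negPf t0) orbF => /eqP.
  by [].
have [E [k k0 [Eu _ E2 BE]]] := conic_normal_form q_irr qu qv (ind _ _ v0 uv).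
(* A member at infinity gets the default parameter 0, which only enlarges the finite set of
   parameters to be avoided. *)
have /fin_all_exists [a aP] i : exists a, row (2%:R) E \notin point_space (P i) ->
    forall c, conic_point E c \in point_space (P i) -> c = a.
  have [_|nE] := boolP (_ \in _); first by exists 0.
  by have [a [aP _]] := tangent_parameter k0 Eu BE nE; exists a.
(* The first normal form provides a point [w] of the conic outside the family; the
   second one gives it the parameter infinity. *)
have [c ca] := avoid_seq (codom a).
pose w := conic_point E c.
have wE2 : w \notin <[v]>%VS.
  rewrite -E2; apply/negP => /vlineP[l]; rewrite /w /conic_point /secant rowE.
  rewrite scalemxAl => /(can_inj (mulmxK Eu)) /rowP/(_ 0).
  by rewrite !mxE /= mulr0 => /eqP; rewrite oner_eq0.
have wP i : w \notin point_space (P i).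
  have [E2P|E2P] := boolP (row (2%:R) E \in point_space (P i)).
    have [p p0 Pp] := point_line (P i); rewrite Pp.
    suff -> : <[p]>%VS = <[v]>%VS by [].
    apply/eqP; rewrite eq_sym eqEdim !dim_vline p0 v0 andbT -memvE -E2.
    by rewrite -Pp.
  by apply: contra ca => /(aP _ E2P)->; apply: codom_f.
have w0 : w != 0 by apply: contraNneq wE2 => ->; rewrite mem0v.
have qw : q.@[w 0] = 0.
  apply: (mulfI (_ : 2%:R != 0)); first by rewrite pnatr_eq0.
  by rewrite mulr0 meval_gram // BE !mxE /=; ring.
have [] := conic_normal_form q_irr qu qw.
  move=> x y xy; suff [] : y = 0 /\ x = 0 by [].
  by apply: (ind w u u0); rewrite -?Pu ?wP // addrC.
move=> E' [k' k'0 [E'u _ E'2 BE']]; exists E' => //.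
have /fin_all_exists [b bP] i : exists b, forall y : 'rV_3, (y *m E' \in line_space (L i)) =
        (b ^+ 2 * y 0 0 - b * y 0 1 + y 0 (2%:R) == 0).
  have E'2P : row (2%:R) E' \notin point_space (P i) by rewrite E'2.
  by have [b [_ bP]] := tangent_parameter k'0 E'u BE' E'2P; exists b.
by exists b.
Qed.

End Parametrization.

(** * Ideals of points and of fat points *)

Section IdealGen.
Local Open Scope ring_scope.
Local Open Scope classical_set_scope.

Variable A : comNzRingType.
Implicit Types (G I : set A) (f g c : A).

Lemma ideal_gen0 G : ideal_gen G 0.
Proof. by exists [::]; rewrite big_nil. Qed.

Lemma ideal_genD G f g : ideal_gen G f -> ideal_gen G g -> ideal_gen G (f + g).
Proof.
move=> [s [sG ->]] [s' [s'G ->]]; exists (s ++ s'); rewrite big_cat; split=> // x.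
by rewrite mem_cat => /orP[/sG|/s'G].
Qed.

Lemma ideal_genM G c f : ideal_gen G f -> ideal_gen G (c * f).
Proof.
move=> [s [sG ->]]; exists [seq (c * x.1, x.2) | x <- s]; split.
  by move=> _ /mapP[x xs ->] /=; apply: sG.
by rewrite big_map mulr_sumr; apply: eq_bigr => x _; rewrite mulrA.
Qed.

Lemma ideal_gen_sub G f : G f -> ideal_gen G f.
Proof.
move=> Gf; exists [:: (1, f)]; rewrite big_seq1 mul1r; split=> // x.
by rewrite inE => /eqP->.
Qed.

Lemma ideal_gen_sum G (T : eqType) (s : seq T) (f : T -> A) :
  (forall x, x \in s -> ideal_gen G (f x)) -> ideal_gen G (\sum_(x <- s) f x).
Proof.
elim: s => [|x s IH] sG; first by rewrite big_nil; apply: ideal_gen0.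
rewrite big_cons; apply: ideal_genD; first by apply: sG; rewrite mem_head.
by apply: IH => y ys; apply: sG; rewrite inE ys orbT.
Qed.

Lemma ideal_pow_prod I m s c : (forall x, x \in s -> I x) -> (m <= size s)%N ->
  ideal_pow I m (c * \prod_(x <- s) x).
Proof.
move=> sI ms; rewrite -(cat_take_drop m s) big_cat /= mulrCA mulrC.
apply/ideal_genM/ideal_gen_sub; have sz : size (take m s) == m by rewrite size_takel.
by exists (Tuple sz); split=> // f /mem_take /sI.
Qed.

End IdealGen.

Section Ideals3.
Local Open Scope ring_scope.
Local Open Scope classical_set_scope.

Variable F : fieldType.
Implicit Types (f g : {mpoly F[3]}) (p : plane_point F).

Lemma ideal_gen_linear (G : set {mpoly F[3]}) a f g :
  ideal_gen G f -> ideal_gen G g -> ideal_gen G (a *: f + g).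
Proof.
by move=> Gf Gg; apply: ideal_genD => //; rewrite -mul_mpolyC; apply: ideal_genM.
Qed.

Lemma mem_ideal_of_form (X : set (plane_point F)) f : is_form f ->
  ideal_of X f <-> forall p, X p -> vanishes_at f p.
Proof.
move=> f_form; split=> [[s [sX ->]] p Xp v vp|fX]; last exact: ideal_gen_sub.
rewrite raddf_sum big_seq big1 // => x /sX[_ /(_ p Xp v vp) x0] /=.
by rewrite mevalM x0 mulr0.
Qed.

Lemma homog_vanishes_at f p v d : f \is d.-homog -> point_space p = <[v]>%VS ->
  f.@[v 0] = 0 -> vanishes_at f p.
Proof.
move=> /dhomogP fd pv fv w; rewrite pv => /vlineP[a ->].
rewrite -[RHS](mulr0 (a ^+ d)) -fv !mevalE mulr_sumr !big_seq.
apply: eq_bigr => m /fd /= <-; rewrite mulrCA; congr (_ * _).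
under eq_bigr => i _ do rewrite mxE exprMn.
by rewrite big_split /= mdegE -expr_sum.
Qed.

(* [f] vanishes to order [m] at the [k]-th coordinate point. *)
Definition order_at (k : 'I_3) (m : nat) f : Prop :=
  forall x, x \in msupp f -> (m + x k <= mdeg x)%N.

Lemma order_at_sum k m (T : eqType) (s : seq T) (f : T -> {mpoly F[3]}) :
  (forall x, x \in s -> order_at k m (f x)) -> order_at k m (\sum_(x <- s) f x).
Proof.
elim: s => [|y s IH] sf; first by move=> x; rewrite big_nil msupp0.
move=> x; rewrite big_cons => /msuppD_le; rewrite mem_cat => /orP[|].
  by apply: sf; rewrite mem_head.
by apply: IH => z zs; apply: sf; rewrite inE zs orbT.
Qed.

Lemma order_atM k m1 m2 f g :
  order_at k m1 f -> order_at k m2 g -> order_at k (m1 + m2) (f * g).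
Proof.
move=> fm gm x /msuppM_le /allpairsP[[y z] /= [yf zg ->]].
by rewrite mnmDE mdegD addnACA leq_add ?fm ?gm.
Qed.

Lemma order_at_prod k (s : seq {mpoly F[3]}) :
  (forall f, f \in s -> order_at k 1 f) -> order_at k (size s) (\prod_(f <- s) f).
Proof.
elim: s => [|f s IH] sk.
  by move=> x; rewrite big_nil msupp1 inE => /eqP->; rewrite mnm0E.
rewrite big_cons /= -add1n; apply: order_atM; first by apply: sk; rewrite mem_head.
by apply: IH => g gs; apply: sk; rewrite inE gs orbT.
Qed.

Section CoordinatePoint.
Variables (E : 'M[F]_3) (k : 'I_3) (p : plane_point F).
Hypotheses (E_unit : E \in unitmx) (pE : point_space p = <[row k E]>%VS).

(** The value at [row k E] is the coefficient of the pure power of ['X_k], the only monomial of its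
    degree with order 0 at the point. *)
Lemma form_order_at f : is_form f -> vanishes_at f p -> order_at k 1 (mx_comp E f).
Proof.
move=> [d /(mx_comp_dhomog E) /dhomogP fd] /(_ (row k E)); rewrite pE memv_line.
rewrite rowE -meval_mx_comp => /(_ isT) f0 x xf; have /= xd := fd _ xf.
rewrite xd add1n ltnNge; apply/negP => dx.
have x0 i : i != k -> x i = 0%N.
  move=> ik; move: xd; rewrite mdegE (bigD1 k) //= (bigD1 i) //=; lia.
have xk : x k = d.
  by rewrite -xd mdegE (bigD1 k) //= big1 ?addn0 // => i /x0.
move: f0; rewrite mevalE (bigD1_seq x) ?msupp_uniq //= [X in _ + X]big_seq_cond.
rewrite [X in _ + X]big1 => [|y /andP[yf yx]].
  rewrite addr0 big1 => [|i _]; last first.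
    by rewrite mxE eqxx; have [->|/x0->] := eqVneq i k; rewrite ?expr1n.
  by move/eqP; rewrite mulr1 mcoeff_eq0 xf.
have /existsP[i /andP[ik yi]] : [exists i, (i != k) && (y i != 0%N)].
  apply: contraNT yx => /existsPn y0.
  have {}y0 i : i != k -> y i = 0%N by move=> ik; have := y0 i; rewrite ik /= negbK => /eqP.
  apply/eqP/mnmP => i; have [->|ik] := eqVneq i k; last by rewrite x0 // y0.
  have := fd _ yf; rewrite /= mdegE (bigD1 k) //= big1 ?addn0 => [->|//].
  by rewrite xk.
by rewrite (bigD1 i) //= mxE (negPf ik) andbF expr0n (negPf yi) mul0r mulr0.
Qed.

(** Orders add up in products, which gives one direction. Conversely, each monomial of order at
    least [m] has at least [m] factors ['X_i] with [i != k], and these are linear forms vanishing at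
    the point. *)
Lemma ideal_pow_point m f :
  ideal_pow (ideal_of [set p]) m f <-> order_at k m (mx_comp E f).
Proof.
split=> [[s [sG ->]]|fm].
  rewrite mx_comp_sum; apply: order_at_sum => x /sG[b [bI ->]].
  have triv g : order_at k 0 g by move=> y _; rewrite mdegE (bigD1 k) //= leq_addr.
  rewrite mx_compM; apply: (@order_atM _ 0) => //.
  rewrite mx_comp_prod; have sz : size (map (mx_comp E) b) = m by rewrite size_map size_tuple.
  rewrite -{1}sz -(big_map (mx_comp E) xpredT id).
  apply: order_at_prod => _ /mapP[g /bI [s' [s'G ->]] ->].
  rewrite mx_comp_sum; apply: order_at_sum => y /s'G [y_form y_van].
  rewrite mx_compM; apply: (@order_atM _ 0) => //.
  by apply: form_order_at => //; apply: y_van.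
rewrite -[f]mx_comp1 -(mulVmx E_unit) -mx_compA mx_compE.
apply: ideal_gen_sum => x /fm xm; rewrite -mul_mpolyC; apply: ideal_genM.
rewrite mx_compX (bigD1 k) //=.
pose l i := mx_comp (invmx E) 'X_i.
pose s := flatten [seq nseq (x i) (l i) | i <- enum 'I_3 & i != k].
have -> : \prod_(i < 3 | i != k) l i ^+ x i = \prod_(g <- s) g.
  rewrite big_flatten big_map big_filter big_enum_cond /=.
  apply: eq_bigr => i _; rewrite big_nseq.
  by elim: (x i) => //= n <-; rewrite exprS.
apply: ideal_pow_prod.
  move=> g /flattenP[_ /mapP[i iP ->]] /nseqP[-> _].
  move: iP; rewrite mem_filter => /andP[ik _].
  have ld : l i \is 1.-homog by rewrite mx_comp_dhomog // dhomogX /= mdeg1.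
  apply/mem_ideal_of_form; first by exists 1%N.
  move=> _ ->; apply: (homog_vanishes_at ld pE).
  by rewrite meval_mx_comp rowE mulmxK // mevalXU mxE eqxx (negPf ik).
rewrite size_flatten /shape -map_comp sumnE big_map big_filter big_enum_cond /=.
under eq_bigr => i _ do rewrite size_nseq.
by move: xm; rewrite mdegE (bigD1 k) //= addnC leq_add2l.
Qed.

End CoordinatePoint.
End Ideals3.

(** * Hilbert functions *)

Section FatPoints.
Local Open Scope ring_scope.
Local Open Scope classical_set_scope.

Variable F : fieldType.

(** In the basis given by the three points the ideal is monomial: a form belongs to it exactly when
    its coefficients at the bad monomials vanish. *)
Lemma hilbert_fat (p1 p2 p3 : plane_point F) (t r s d : nat) :
  ~ collinear p1 p2 p3 -> (0 < t)%N -> (0 < r)%N -> (r + s <= t.+1)%N ->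
  hilbert_function (fat_ideal p1 p2 p3 (t - 1) (r - 1) (s - 1)) d = hilbert_value t r s d.
Proof.
move=> ncol t0 r0 rst.
have [u _ p1u] := point_line p1; have [v _ p2v] := point_line p2.
have [w _ p3w] := point_line p3.
have Eu := noncollinear_unit p1u p2v p3w ncol.
set E := rows3 u v w in Eu.
have p1E : point_space p1 = <[row 0%R E]>%VS by rewrite rowK.
have p2E : point_space p2 = <[row 1%R E]>%VS by rewrite rowK.
have p3E : point_space p3 = <[row (2%:R)%R E]>%VS by rewrite rowK.
(* The third exponent completes the degree to [d]; index pairs of sum above [d], where it truncates,
   are not in [A]. *)
pose mono (x : 'I_d.+1 * 'I_d.+1) : 'X_{1..3} :=
  [multinom nth 0%N [:: nat_of_ord x.1; nat_of_ord x.2; (d - x.1 - x.2)%N] i | i < 3].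
pose ev x (f : dhomog 3 F d) : F := (mx_comp E (mpoly_of_dhomog f))@_(mono x).
have ev_lin x : linear_for *%R (ev x).
  move=> a f g; rewrite /ev (linearP (@mpoly_of_dhomog 3 F d)).
  by rewrite (linearP (mx_comp E)) mcoeffD mcoeffZ.
pose evL x : {scalar dhomog 3 F d} :=
  HB.pack (ev x) (GRing.isLinear.Build F (dhomog 3 F d) F *%R (ev x) (ev_lin x)).
pose A := [set x : 'I_d.+1 * 'I_d.+1 | bad_monomial t r s d x.1 x.2]%SET.
have mdeg_mono (x : 'I_d.+1 * 'I_d.+1) : (x.1 + x.2 <= d)%N -> mdeg (mono x) = d.
  by rewrite mdegE sum_ord3 !mnmE /=; lia.
have /fin_all_exists [g gE] (x : 'I_d.+1 * 'I_d.+1) : exists g : dhomog 3 F d,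
    x \in A -> forall y, ev y g = (x == y)%:R.
  have [|_] := boolP (x \in A); last by exists 0.
  rewrite inE => /andP[/mdeg_mono xd _].
  have gd : mx_comp (invmx E) 'X_[mono x] \is d.-homog.
    by rewrite mx_comp_dhomog // dhomogX /= xd.
  exists (DHomog gd) => _ y; rewrite /ev /= mx_compA mulmxV // mx_comp1 mcoeffX.
  congr (nat_of_bool _)%:R; apply/eqP/eqP => [/mnmP xy|-> //].
  have := xy 0; have := xy 1; rewrite !mnmE /=.
  by case: x y {xd gd xy} => [x1 x2] [y1 y2] /= /val_inj -> /val_inj ->.
(* Monomials are dual to coefficients, so that the matrix of conditions is the identity and a
   constant rank will do. *)
rewrite /hilbert_function (@dim_zeros_triangular _ _ _ evL A _ (fun _ => 0%N) g).
- rewrite -sum1dep_card big_mkcond /= -card_bad_monomials //.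
  rewrite -(pair_bigA _ (fun x y : 'I_d.+1 => if bad_monomial t r s d x y then 1%N else 0%N)).
  by apply: eq_bigr => x _; apply: eq_bigr => y _; case: bad_monomial.
- move=> f; have /dhomogP fd := mx_comp_dhomog E (dhomog_is_dhomog f).
  have memU : f \in graded_piece (fat_ideal p1 p2 p3 (t - 1) (r - 1) (s - 1)) d <->
      [/\ order_at 0 (t - 1) (mx_comp E (mpoly_of_dhomog f)),
          order_at 1 (r - 1) (mx_comp E (mpoly_of_dhomog f))
        & order_at (2%:R) (s - 1) (mx_comp E (mpoly_of_dhomog f))].
    apply: iff_trans (mem_graded_piece _ _ f) _.
    - by split; [split|]; apply: ideal_gen0.
    - move=> c h k [[h1 h2] h3] [[k1 k2] k3].
      by split; [split|]; apply: ideal_gen_linear.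
    split=> [[[]]|[]].
      by move=> /(ideal_pow_point Eu p1E) ? /(ideal_pow_point Eu p2E) ?
        /(ideal_pow_point Eu p3E) ?.
    by move=> /(ideal_pow_point Eu p1E) ? /(ideal_pow_point Eu p2E) ?
        /(ideal_pow_point Eu p3E) ?.
  apply/idP/forall_inP => [/memU[o1 o2 o3] x | f0].
    rewrite inE => /andP[xd bad]; rewrite /= /ev mcoeff_eq0; apply/negP => xf.
    move: (o1 _ xf) (o2 _ xf) (o3 _ xf) bad.
    by rewrite mdeg_mono // !mnmE /=; lia.
  suff nbad y : y \in msupp (mx_comp E (mpoly_of_dhomog f)) ->
      mdeg y = d /\ ~~ bad_monomial t r s d (y 0) (y 1).
    apply/memU; split=> y /nbad[yd]; rewrite yd; move: yd;
      rewrite mdegE sum_ord3 /bad_monomial; lia.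
  move=> yf; have /= yd := fd _ yf; split=> //.
  move: (yd); rewrite mdegE sum_ord3 => yE.
  have [y0 y1] : (y 0%R < d.+1)%N /\ (y 1%R < d.+1)%N by lia.
  apply/negP => bad; have := f0 (Ordinal y0, Ordinal y1); rewrite inE => /(_ bad).
  rewrite /= /ev mcoeff_eq0 => /negP; apply.
  suff -> : mono (Ordinal y0, Ordinal y1) = y by [].
  apply/mnmP => i; rewrite mnmE.
  case: i => [[|[|[|]]]] //= p; [| |have -> : (d - y 0%R - y 1%R)%N = y (2%:R) by lia];
    by congr (y _); apply/val_inj.
- by move=> x xA; rewrite /= gE // eqxx oner_eq0.
by move=> x y xA _ yx; rewrite /= gE // [x == y]eq_sym (negPf yx) eqxx.
Qed.

End FatPoints.

Section Contact.
Local Open Scope ring_scope.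
Local Open Scope classical_set_scope.

Variable F : numClosedFieldType.
Variables (q : {mpoly F[3]}) (r s t : nat).
Variables (l : 'I_r -> plane_line F) (m : 'I_s -> plane_line F) (n : 'I_t -> plane_line F).
Hypothesis q_irr : irreducible_conic q.
Hypothesis l_contact : contact_star q l.
Hypothesis m_contact : contact_star q m.
Hypothesis n_contact : contact_star q n.
Hypothesis lmn_uniq : uniq (codom l ++ codom m ++ codom n).

(** The star of [n] comes first, since label 0 marks the star called [w] in the count of basic
    pairs. *)
Definition tangent_line (x : tangents t r s) : plane_line F :=
  match x with inl i => n i | inr (inl i) => l i | inr (inr i) => m i end.

Lemma tangent_line_inj : injective tangent_line.
Proof.
move: lmn_uniq; rewrite !cat_uniq has_cat negb_or.
case/and3P=> /injectiveP l_inj /andP[/hasPn ml /hasPn nl].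
case/and3P=> /injectiveP m_inj /hasPn nm /injectiveP n_inj.
case=> [i|[i|i]] [j|[j|j]] /= e; try by rewrite ?(l_inj _ _ e) ?(m_inj _ _ e) ?(n_inj _ _ e).
- by have := nl _ (codom_f n i); rewrite e /= codom_f.
- by have := nm _ (codom_f n i); rewrite e /= codom_f.
- by have := nl _ (codom_f n j); rewrite -e /= codom_f.
- by have := ml _ (codom_f m j); rewrite -e /= codom_f.
- by have := nm _ (codom_f n j); rewrite -e /= codom_f.
by have := ml _ (codom_f m i); rewrite e /= codom_f.
Qed.

Lemma mem_stars (p : plane_point F) :
  (star l `|` star m `|` star n) p <->
  exists x y, [/\ x != y, tangent_star x = tangent_star y,
    on_line p (tangent_line x) & on_line p (tangent_line y)].
Proof.
split=> [[[|]|] [i [j [ij pi pj]]]|[x [y [xy cxy px py]]]].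
- exists (inr (inl i)), (inr (inl j)); split=> //.
  by apply: contraTneq ij => -[->]; rewrite ltnn.
- exists (inr (inr i)), (inr (inr j)); split=> //.
  by apply: contraTneq ij => -[->]; rewrite ltnn.
- exists (inl i), (inl j); split=> //.
  by apply: contraTneq ij => -[->]; rewrite ltnn.
wlog lxy : x y xy cxy px py / (tangent_pos x < tangent_pos y)%N.
  move=> W; case: (ltngtP (tangent_pos x) (tangent_pos y)) => [|lyx|/(tangent_pos_inj cxy) e].
  - exact: W.
  - by apply: (W y x) => //; rewrite eq_sym.
  by move: xy; rewrite e eqxx.
by case: x y {xy} cxy px py lxy => [i|[i|i]] [j|[j|j]] //= _ pi pj ij;
  [right|left; left|left; right]; exists i, j.
Qed.

(** In the coordinates of [E] the tangents with parameters [a] and [b] meet at [secant E a b], so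
    that the degree [d] piece of the ideal is the space measured by [dim_secant_forms]. *)
Lemma hilbert_contact d : (1 < t)%N -> (r + s <= t.+1)%N ->
  hilbert_function (ideal_of (star l `|` star m `|` star n)) d = hilbert_value t r s d.
Proof.
move=> t1 rst; have [[Pl _ tl] [Pm _ tm] [Pn Pn_inj tn]] := And3 l_contact m_contact n_contact.
pose P (x : tangents t r s) : plane_point F :=
  match x with inl i => Pn i | inr (inl i) => Pl i | inr (inr i) => Pm i end.
have tanP x : tangent_at q (P x) (tangent_line x) by case: x => [i|[i|i]] /=.
have P01 : P (inl (Ordinal (ltnW t1))) <> P (inl (Ordinal t1)).
  by move=> /Pn_inj.
have [E Eu [a aE]] := contact_parametrization q_irr tanP P01.
have a_inj : injective a.
  move=> x y axy; apply/tangent_line_inj/val_inj/vspaceP => v /=.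
  by rewrite -[v](mulmxKV Eu) !aE axy.
rewrite -card_tangent_pairs /hilbert_function.
apply: (dim_secant_forms a_inj (@tangent_pos_inj t r s) (@card_tangent_pos t r s) _ Eu).
  by rewrite card_small_tangents.
have on_secant x y : secant E (a x) (a y) \in line_space (tangent_line x).
  by rewrite /secant aE !mxE /=; apply/eqP; ring.
have secant0 x y : secant E x y != 0.
  apply/eqP => /(congr1 (mulmx^~ (invmx E))); rewrite /secant mulmxK // mul0mx.
  by move=> /rowP/(_ 0); rewrite !mxE /= => /eqP; rewrite oner_eq0.
move=> f; have fd := dhomog_is_dhomog f.
have f_form : is_form (mpoly_of_dhomog f) by exists d.
apply: iff_trans (mem_graded_piece _ _ f) _.
- exact: ideal_gen0.
- by move=> c g h; apply: ideal_gen_linear.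
apply: iff_trans (mem_ideal_of_form _ f_form) _.
split=> [fG x y xy cxy|f0 p /mem_stars[x [y [xy cxy px py]]]].
  have dim1 : \dim <[secant E (a x) (a y)]>%VS == 1%N by rewrite dim_vline secant0.
  apply: (fG (Point dim1)); last exact: memv_line.
  apply/mem_stars; exists x, y; split=> //; rewrite /on_line /= -memvE //.
  by rewrite secantC.
have [v v0 pv] := point_line p.
have [u vE] : exists u, v = u *m E by exists (v *m invmx E); rewrite mulmxKV.
move: px py; rewrite /on_line pv -!memvE vE !aE => /eqP ux /eqP uy.
have axy : a x - a y != 0 by rewrite subr_eq0 (inj_eq a_inj).
(* The two tangent equations are subtracted and divided by the difference of the parameters. *)
have u1 : u 0 1 = (a x + a y) * u 0 0.
  have : (a x - a y) * ((a x + a y) * u 0 0 - u 0 1) = 0.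
    transitivity ((a x ^+ 2 * u 0 0 - a x * u 0 1 + u 0 (2%:R))
      - (a y ^+ 2 * u 0 0 - a y * u 0 1 + u 0 (2%:R))); first by ring.
    by rewrite ux uy subrr.
  by move/eqP; rewrite mulf_eq0 (negPf axy) subr_eq0 => /eqP.
have u2 : u 0 (2%:R) = a x * a y * u 0 0.
  transitivity (a x * a y * u 0 0 + (a x ^+ 2 * u 0 0 - a x * u 0 1 + u 0 (2%:R))).
    by rewrite u1; ring.
  by rewrite ux addr0.
have uE : u = u 0 0 *: \row_i [:: 1; a x + a y; a x * a y]`_i.
  apply/rowP => -[[|[|[|]]] //= i3]; rewrite !mxE /=.
  - by rewrite mulr1; congr (u 0 _); apply/val_inj.
  - by rewrite mulrC -u1; congr (u 0 _); apply/val_inj.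
  by rewrite mulrC -u2; congr (u 0 _); apply/val_inj.
have vs : v = u 0 0 *: secant E (a x) (a y) by rewrite vE {1}uE -scalemxAl.
have u00 : u 0 0 != 0 by apply: contraNneq v0 => u00; rewrite vs u00 scale0r.
apply: (homog_vanishes_at fd) (f0 x y xy cxy).
by rewrite pv; apply/eqP; rewrite eqEdim !dim_vline v0 secant0 -memvE vs memvZ ?memv_line.
Qed.

End Contact.

Section HVector.

(** While [d.+1 < t] the Hilbert function is that of all forms, with difference [d.+1]; from then on
    the difference is the newest summand of [hilbert_value]. *)
Lemma h_vector_expected (F : fieldType) (I : set {mpoly F[3]}) (t r s d : nat) :
  (forall e, hilbert_function I e = hilbert_value t r s e) ->
  1 < t -> 0 < s <= r -> h_vector I d = (nth 0 (expected_h t r s) d)%:Z%R.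
Proof.
move=> HI t1 /andP[s0 sr]; rewrite nth_expected_h ?(ltnW t1) // /h_vector.
case: d => [|d].
  by rewrite HI t1 hilbert_value_low // subr0.
rewrite !HI; apply/eqP; rewrite subr_eq -PoszD; apply/eqP; congr Posz.
case: ltnP => dt.
  by rewrite !hilbert_value_low ?(ltnW dt) // binS bin1 addnC.
by rewrite hilbert_value_step // addnC.
Qed.

End HVector.

Local Open Scope classical_set_scope.

Theorem theorem4p5 (R : realType) (gamma : {mpoly (complex R)[3]})
    (r s t : nat)
    (l : 'I_r -> plane_line (complex R)) (m : 'I_s -> plane_line (complex R))
    (n : 'I_t -> plane_line (complex R))
    (P1 P2 P3 : plane_point (complex R)) :
  irreducible_conic gamma ->
  (s <= r <= t)%N -> (2 <= s)%N ->
  contact_star gamma l -> contact_star gamma m -> contact_star gamma n ->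
  uniq (codom l ++ codom m ++ codom n) ->
  ~ collinear P1 P2 P3 ->
  t \in [:: r + s - 1; r + s; r + s + 1]%N ->
  let h_XYW := h_vector (ideal_of (star l `|` star m `|` star n)) in
  let h_Z := h_vector (fat_ideal P1 P2 P3 (t - 1) (r - 1) (s - 1)) in
  h_XYW = h_Z /\
  written_as h_Z
    (iota 1 (t - 1)
     ++ [seq (r + s - 2 - 2 * i)%N | i <- iota 0 (s - 1)]
     ++ [seq (r - s - i)%N | i <- iota 0 (r - s)]).
Proof.
move=> g_irr /andP[sr rt] s2 lc mc nc lmn ncol tE h_XYW h_Z.
(* All three values of [t] give this bound, on which the independence of the conditions and the
   count of monomials rest. *)
have rst : r + s <= t.+1 by move: tE; rewrite !inE => /or3P[] /eqP ->; lia.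
have hXYW d := hilbert_contact g_irr lc mc nc lmn d (leq_trans s2 (leq_trans sr rt)) rst.
have hZ d := @hilbert_fat _ P1 P2 P3 t r s d ncol
  (ltn_trans (ltn0Sn 0) (leq_trans s2 (leq_trans sr rt)))
  (ltn_trans (ltn0Sn 0) (leq_trans s2 sr)) rst.
have t1 := leq_trans s2 (leq_trans sr rt).
have sr' : 0 < s <= r by rewrite sr ltnW.
split; first by apply/funext => d; rewrite /h_XYW /h_Z !(h_vector_expected _ _ t1 sr').
split=> [d|]; first by rewrite /h_Z (h_vector_expected _ hZ t1 sr').
exact: last_expected_h.
Qed.
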